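(* Let $V$ be a subset of $[1,n]$ such that every $I\in\mathcal I[V]$ has cardinality at least $2$, and every $I\in\mathcal I[[0,n+1]\setminus V]$ has cardinality at most $3$. Assume that $M$ is a subset of $V$ such that every $[a,b]\in\mathcal I[V]$ satisfies the following: (i) $M\cap[a,b]=\emptyset$, $[a,a+1]$, or $[b-1,b]$; (ii) if $a\notin M$ then $a-2\in\{-1\}\cup M$; (iii) if $b\notin M$ then $b+2\in\{n+2\}\cup M$. Then the inequality $$(-1)^{|M|/2}\sum_{M\subseteq Q\subseteq V}L_Q(P)\ge 0$$ determines a facet of the closed cone $\mathcal C^{n+1}_{\mathcal E}$ of flag vectors of Eulerian posets of rank $n+1$ (where $L_Q$ is regarded as a linear form in the flag numbers $f_T$). Furthermore, if (i) is strengthened by also requiring $M\cap[a,a+2]=\emptyset$ for every $[a,a+2]\in\mathcal I[V]$ (every interval of $\mathcal I[V]$ of cardinality exactly $3$), then distinct pairs $(M,V)$ give distinct facets.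
   Context: $[a,b]=\{a,a+1,\dots,b\}$ for integers $a\le b$. For a finite set $S$ of integers, $\mathcal I[S]$ is the collection of maximal intervals (of consecutive integers) contained in $S$. A graded poset is a finite partially ordered set $P$ with a unique minimum $\hat 0$, a unique maximum $\hat 1$, and a rank function $\rho:P\to\mathbf{N}$ with $\rho(\hat 0)=0$ and $\rho(y)-\rho(x)=1$ whenever $y$ covers $x$; its rank is $\rho(\hat 1)$. For $P$ of rank $n+1$ and $S\subseteq[1,n]$, $f_S(P)$ is the number of chains $x_1<\cdots<x_{|S|}$ in $P$ with $\{\rho(x_1),\dots,\rho(x_{|S|})\}=S$; the flag vector is $(f_S(P):S\subseteq[1,n])\in\mathbf{R}^{2^n}$. $P$ is Eulerian if $\mu([x,y])=(-1)^{\rho(y)-\rho(x)}$ for every interval $[x,y]$ of $P$. The flag $L$-vector of $P$ is given by $$L_S(P)=(-1)^{n-|S|}\sum_{T\supseteq[1,n]\setminus S}\left(-\tfrac12\right)^{|T|}f_T(P),\qquad S\subseteq[1,n],$$ an invertible linear transformation of the flag vector. $\mathcal{C}^{n+1}_{\mathcal E}$ is the closure of the convex cone generated by the flag vectors of all Eulerian posets of rank $n+1$; its linear span (the Eulerian subspace) has dimension equal to the number of even subsets of $[1,n]$ (subsets all of whose maximal intervals have even length). A linear inequality determines a facet if it is valid on the cone and the points of the cone at which equality holds form a face of dimension one less than that of the cone. (Equivalently one may work with the corresponding closed cone of $L$-vectors.) *)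

(* Defs.v *)
From HB Require Import structures.
From mathcomp Require Import all_boot all_order all_algebra.
From mathcomp Require Import all_classical all_reals all_analysis.

Set Implicit Arguments.
Unset Strict Implicit.
Unset Printing Implicit Defensive.

Import Order.TTheory GRing.Theory Num.Theory.
Import numFieldNormedType.Exports.

Local Open Scope classical_set_scope.
Local Open Scope ring_scope.

(* A subset of [1,n] is encoded as S : {set 'I_n}, the ordinal i standing for
   the integer i + 1; [elts S] is the subset of [1,n] itself. *)
Definition elts (n : nat) (S : {set 'I_n}) : set int :=
  [set (i.+1)%:Z | i in [set` S]].

Definition zint (a b : int) : set int := [set k | a <= k <= b].

(* [a, b] is a member of I[S] *)
Definition max_interval (S : set int) (a b : int) : Prop :=
  [/\ a <= b, zint a b `<=` S &
      forall c d : int, c <= d -> zint c d `<=` S -> zint a b `<=` zint c d ->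
        zint c d = zint a b].

Section Posets.
Context {d : Order.disp_t} {P : finTBPOrderType d}.

Definition covers (y x : P) : Prop :=
  (x < y)%O /\ forall z : P, ~ ((x < z)%O /\ (z < y)%O).

Definition rank_function (rho : P -> nat) : Prop :=
  rho \bot%O = 0%N /\ forall x y : P, covers y x -> rho y = (rho x).+1.

Definition moebius_function (mu : P -> P -> int) : Prop :=
  (forall x : P, mu x x = 1) /\
  (forall x y : P, (x < y)%O -> \sum_(z : P | (x <= z <= y)%O) mu x z = 0).

Definition eulerian (rho : P -> nat) : Prop :=
  exists2 mu : P -> P -> int, moebius_function mu &
    forall x y : P, (x <= y)%O -> mu x y = (-1) ^+ (rho y - rho x)%N.

(* When rho is the rank function, both sequences below are duplicate-free, so
   [perm_eq] compares them as sets. *)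
Definition flag_number (rho : P -> nat) (n : nat) (S : {set 'I_n}) : nat :=
  #|[pred t : #|S|.-tuple P | sorted (fun x y : P => (x < y)%O) t
      && perm_eq [seq rho x | x <- t] [seq i.+1 | i : 'I_n <- enum S]]|.

End Posets.

(* R^(2^n), with coordinates indexed by the subsets of [1,n]; row vectors carry
   both the topology and the vector space structure. *)
Definition coordS (R : realType) (n : nat) (v : 'rV[R]_#|{: {set 'I_n}}|)
  (S : {set 'I_n}) : R := v ord0 (enum_rank S).

Definition flag_vector (R : realType) (n : nat) (d : Order.disp_t)
    (P : finTBPOrderType d) (rho : P -> nat) : 'rV[R]_#|{: {set 'I_n}}| :=
  \row_j (flag_number rho (enum_val j : {set 'I_n}))%:R.

Definition flagL (R : realType) (n : nat) (S : {set 'I_n})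
    (v : 'rV[R]_#|{: {set 'I_n}}|) : R :=
  (-1) ^+ (n - #|S|)%N *
  \sum_(T : {set 'I_n} | ~: S \subset T) (- (1 / 2)) ^+ #|T| * coordS v T.

Definition eulerian_flag_vectors (R : realType) (n : nat) :
    set 'rV[R]_#|{: {set 'I_n}}| :=
  [set v | exists (d : Order.disp_t) (P : finTBPOrderType d) (rho : P -> nat),
    [/\ rank_function rho, rho \top%O = n.+1, eulerian rho &
        v = flag_vector R n rho]].

Definition convex_cone (R : realType) (E : lmodType R) (A : set E) : set E :=
  [set v | exists (k : nat) (c : 'I_k -> R) (a : 'I_k -> E),
    [/\ forall i, 0 <= c i, forall i, A (a i) & v = \sum_(i < k) c i *: a i]].

Definition eulerian_cone (R : realType) (n : nat) :
    set 'rV[R]_#|{: {set 'I_n}}| :=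
  closure (convex_cone (@eulerian_flag_vectors R n)).

Definition linear_span (R : realType) (E : vectType R) (A : set E)
    (U : {vspace E}) : Prop :=
  (forall x, A x -> x \in U) /\
  (forall W : {vspace E}, (forall x, A x -> x \in W) -> (U <= W)%VS).

Definition equality_face (R : realType) (E : lmodType R) (C : set E)
  (l : E -> R) : set E := [set x | C x /\ l x = 0].

(* The cone and its face {l = 0} both contain 0, so that their dimensions are
   the dimensions of their linear spans. *)
Definition determines_facet (R : realType) (E : vectType R) (C : set E)
    (l : E -> R) : Prop :=
  (forall x, C x -> 0 <= l x) /\
  exists U W : {vspace E},
    [/\ linear_span C U, linear_span (equality_face C l) W &
        (\dim W).+1 = \dim U].

Definition facet_form (R : realType) (n : nat) (M V : {set 'I_n})
    (v : 'rV[R]_#|{: {set 'I_n}}|) : R :=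
  (-1) ^+ (#|M|./2) *
  \sum_(Q : {set 'I_n} | (M \subset Q) && (Q \subset V)) flagL Q v.

Definition large_intervals (n : nat) (V : {set 'I_n}) : Prop :=
  (forall a b : int, max_interval (elts V) a b -> 2 <= b - a + 1) /\
  (forall a b : int, max_interval (zint 0 (n.+1%:Z) `\` elts V) a b ->
     b - a + 1 <= 3).

Definition condition_i (n : nat) (M : {set 'I_n}) (a b : int) : Prop :=
  [\/ elts M `&` zint a b = set0,
      elts M `&` zint a b = zint a (a + 1) |
      elts M `&` zint a b = zint (b - 1) b].

Definition condition_ii (n : nat) (M : {set 'I_n}) (a : int) : Prop :=
  ~ elts M a -> ([set -1] `|` elts M) (a - 2).

Definition condition_iii (n : nat) (M : {set 'I_n}) (b : int) : Prop :=
  ~ elts M b -> ([set n.+2%:Z] `|` elts M) (b + 2).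

Definition admissible_pair (n : nat) (M V : {set 'I_n}) : Prop :=
  [/\ large_intervals V, M \subset V &
      forall a b : int, max_interval (elts V) a b ->
        [/\ condition_i M a b, condition_ii M a & condition_iii M b]].

Definition strongly_admissible_pair (n : nat) (M V : {set 'I_n}) : Prop :=
  admissible_pair M V /\
  forall a : int, max_interval (elts V) a (a + 2) ->
    elts M `&` zint a (a + 2) = set0.

(* Main.v *)
Require Import Defs.
From HB Require Import structures.
From mathcomp Require Import all_boot all_order all_algebra.
From mathcomp Require Import all_classical all_reals all_analysis.
From mathcomp Require Import zify ring lra.

(** Under the inverse of the L-transform, the vector with a single nonzero
    L-coordinate at Q is [dual_vec Q].

    Validity.  For an Eulerian poset L_Q vanishes unless Q is even, so summing
    over Q containing M amounts to summing over Q containing a set T with one end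
    of each pair of M; T meets each interval of V at most once, and the sum
    becomes a sum over chains of products of factors (number of elements of rank
    t in an interval) - 2, which are nonnegative in Eulerian posets.

    Dimension.  Split an even set Q into even blocks; the horizontal double of
    the poset with N copies of each block is Eulerian, and its normalized flag
    vectors tend, as N grows, to the alternating sum of dual vectors of the
    unions of blocks.  The leading term is dual_vec Q, so these limits form a
    basis of the even subspace.  The form vanishes on the limit if some block
    lies in V - M, or if some block meets M without lying in V.  For Q <> M one of
    the two can be arranged, with pairs as blocks or after gluing two adjacent
    pairs; for Q = M the form does not vanish.

    Distinctness.  Equal facets force proportional forms on the even subspace,
    hence the same even sets between M and V, and these determine M and V. *)

Set Implicit Arguments.
Unset Strict Implicit.
Unset Printing Implicit Defensive.

Import Order.TTheory GRing.Theory Num.Theory.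
Import numFieldNormedType.Exports.

Local Open Scope ring_scope.

(** * Rank functions and sign sums in Eulerian posets *)

Section RankFunction.
Context {d : Order.disp_t} {P : finTBPOrderType d}.
Variable rho : P -> nat.
Hypothesis rhoP : rank_function rho.

(** Among the elements above [x] and at most [y], one with the fewest elements below it is a cover
    of [x]. *)
Lemma exists_cover (x y : P) :
  (x < y)%O -> exists z, [/\ covers z x, (x < z)%O & (z <= y)%O].
Proof.
move=> xy; pose A := [pred z | (x < z <= y)%O].
have Ay : A y by rewrite /= xy lexx.
case: (arg_minnP (fun z : P => #|[pred t | (t <= z)%O]|) Ay) => z /andP[xz zy] zmin.
exists z; split=> //; split=> // t [xt tz].
have /zmin : A t by rewrite /= xt (le_trans (ltW tz) zy).
rewrite leqNgt => /negP; apply; apply: proper_card; apply/properP; split.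
  by apply/fintype.subsetP => u; rewrite !inE => /le_trans; apply; exact: ltW.
by exists z; rewrite !inE // lt_geF.
Qed.

Lemma rank_lt (x y : P) : (x < y)%O -> (rho x < rho y)%N.
Proof.
pose D (x : P) := #|[pred t | (x <= t)%O]|.
have [k] := ubnP (D x); elim: k x => // k IH x Dk xy.
have [z [/rhoP.2 rz xz zy]] := exists_cover xy.
case: (eqVneq z y) => [<-|zy']; first by rewrite rz.
have zlty : (z < y)%O by rewrite lt_neqAle zy zy'.
have := IH z _ zlty; rewrite rz => IHz; suff: (D z < D x)%N by lia.
apply: proper_card; apply/properP; split.
  by apply/fintype.subsetP => u; rewrite !inE; exact/le_trans/ltW.
by exists x; rewrite !inE // lt_geF.
Qed.

Lemma exists_rank (x y : P) (t : nat) : (x < y)%O -> (rho x < t <= rho y)%N ->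
  exists z, [/\ (x < z)%O, (z <= y)%O & rho z = t].
Proof.
have [k] := ubnP (t - rho x); elim: k x => // k IH x kt xy /andP[xt ty].
have [z [/rhoP.2 rz xz zy]] := exists_cover xy.
have [tz|tz] := eqVneq t (rho z); first by exists z.
have zlty : (z < y)%O.
  by rewrite lt_neqAle zy andbT; apply: contra_neq tz => zy'; rewrite zy' in rz *; lia.
have [|//||z' [zz' z'y rz']] := IH z; [lia|lia|].
by exists z'; rewrite (lt_trans xz zz').
Qed.

Lemma rank_between (x y : P) (t : nat) : (x < y)%O -> (rho x < t < rho y)%N ->
  exists z, [/\ (x < z)%O, (z < y)%O & rho z = t].
Proof.
move=> xy /andP[xt ty].
have [|z [xz zy rz]] := @exists_rank x y t xy; first by lia.
exists z; split=> //; rewrite lt_neqAle zy andbT.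
by apply: contraTneq ty => <-; rewrite rz; lia.
Qed.

Lemma rank_eq_top (x : P) : rho x = rho \top%O -> x = \top%O.
Proof.
move=> rx; apply/eqP; apply: contraT => x1.
have /rank_lt : (x < \top)%O by rewrite lt_neqAle x1 lex1.
by rewrite rx ltnn.
Qed.

Hypothesis eulerP : eulerian rho.

Lemma euler_sum (R : pzRingType) (x y : P) : (x < y)%O ->
  \sum_(z | (x <= z <= y)%O) (-1) ^+ rho z = 0 :> R.
Proof.
case: eulerP => mu [_ muP] muE xy.
transitivity ((-1) ^+ rho x * (\sum_(z | (x <= z <= y)%O) mu x z)%:~R : R).
  rewrite rmorph_sum mulr_sumr; apply: eq_bigr => z /andP[xz zy].
  rewrite muE // rmorphXn /= rmorphN1 -exprD; congr (_ ^+ _).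
  suff: (rho x <= rho z)%N by lia.
  by move: xz; rewrite le_eqVlt => /predU1P[->//|/rank_lt/ltnW].
by rewrite muP // mulr0.
Qed.

(** Around an element [z] of rank [t], choose [u] and [w] of ranks [t - 1] and [t + 1]. The Eulerian
    relation on the interval from [u] to [w] forces exactly two elements strictly inside, and both
    lie between [x] and [y]. *)
Lemma two_between (x y : P) (t : nat) : (x < y)%O -> (rho x < t < rho y)%N ->
  (2 <= #|[pred z | (x < z < y)%O && (rho z == t)]|)%N.
Proof.
move=> xy tb.
have [z [xz zy rz]] := rank_between xy tb.
have [u [xu uz ru]] : exists u, [/\ (x <= u)%O, (u < z)%O & rho u = t.-1].
  have [E|ne] := eqVneq (rho x) t.-1; first by exists x.
  have [|u [xu uz ru]] := @rank_between x z t.-1 xz; first by lia.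
  by exists u; split=> //; exact: ltW.
have [w [uw zw wy rw]] : exists w, [/\ (u < w)%O, (z < w)%O, (w <= y)%O & rho w = t.+1].
  have [|w [zw wy rw]] := @exists_rank z y t.+1 zy; [lia|].
  by exists w; rewrite (lt_trans uz zw).
have := euler_sum int uw.
rewrite (bigD1 u) ?lexx ?ltW //= (bigD1 w) ?lexx ?ltW ?(gt_eqF uw) //=.
rewrite (eq_bigl (fun z => (u < z < w)%O)); last first.
  by move=> s; rewrite !lt_neqAle eq_sym; do 4 case: (_ == _) || case: (_ <= _)%O.
rewrite (eq_bigr (fun=> (-1) ^+ t)); last first.
  move=> s /andP[/rank_lt us /rank_lt sw]; congr (_ ^+ _); lia.
rewrite sumr_const ru rw => H.
have cardE : #|[pred z | (u < z < w)%O]| = 2%N.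
  case: (t) rz H tb => [|k]; first by lia.
  move=> _ /eqP; rewrite /= !exprS !mulN1r opprK -mulr_natr.
  rewrite [X in X == _](_ : _ = (-1) ^+ k * (2 - #|[pred z | (u < z < w)%O]|%:R)); last by ring.
  by rewrite mulf_eq0 signr_eq0 /= => /eqP; lia.
rewrite -{1}cardE; apply/subset_leq_card/fintype.subsetP => s; rewrite !inE.
move=> /andP[us sw]; rewrite (le_lt_trans xu us) (lt_le_trans sw wy) /=.
by move/rank_lt: us; move/rank_lt: sw; lia.
Qed.

(* Let e be +1 on rank B and -1 below.  The hypothesis reads zeta F = e F, and
   since (-1)^rho zeta (-1)^rho is the inverse of zeta, (-1)^rho e F solves the
   same triangular system; comparing the values at rank B gives the claim. *)
Lemma euler_parity (R : realFieldType) (F : P -> R) (B : nat) :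
  (forall x, (rho x < B)%N ->
     2 * F x + \sum_(z | (x < z)%O && (rho z <= B)%N) F z = 0) ->
  forall x, (rho x < B)%N -> ~~ odd (B - rho x) -> F x = 0.
Proof.
move=> FE.
have splitx x (G : P -> R) : (rho x <= B)%N ->
    \sum_(z | (x <= z)%O && (rho z <= B)%N) G z =
    G x + \sum_(z | (x < z)%O && (rho z <= B)%N) G z.
  move=> xB; rewrite (bigD1 x) ?lexx //=; congr (_ + _); apply: eq_bigl => z.
  by rewrite lt_neqAle [x == z]eq_sym; do 3 case: (_ <= _)%O || case: (_ == _) || case: (_ <= _)%N.
pose s (z : P) : R := (-1) ^+ rho z.
pose e (z : P) : R := if rho z == B then 1 else -1.
have zF x : (rho x <= B)%N -> \sum_(z | (x <= z)%O && (rho z <= B)%N) F z = e x * F x.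
  move=> xB; rewrite splitx // /e; have [E|ne] := eqVneq (rho x) B.
    rewrite big1 ?addr0 ?mul1r // => z /andP[/rank_lt]; lia.
  by have := FE x; rewrite ltn_neqAle ne xB => /(_ isT) H; lra.
pose G z := s z * e z * F z.
have zG x : (rho x <= B)%N -> \sum_(z | (x <= z)%O && (rho z <= B)%N) G z = e x * G x.
  move=> xB; transitivity (\sum_(z | (x <= z)%O && (rho z <= B)%N) s z *
     (\sum_(y | (z <= y)%O && (rho y <= B)%N) F y)).
    by apply: eq_bigr => z /andP[_ zB]; rewrite zF // /G mulrA.
  under eq_bigr do rewrite mulr_sumr.
  rewrite (exchange_big_dep (fun y => (x <= y)%O && (rho y <= B)%N)) /=; last first.
    by move=> z y /andP[xz _] /andP[zy ->]; rewrite (le_trans xz zy).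
  rewrite (bigD1 x) ?lexx //= [X in _ + X]big1 ?addr0.
    rewrite (big_pred1 x) ?[in RHS]/G.
      by rewrite /e; case: ifP => _; ring.
    move=> z /=; rewrite [RHS]eq_le xB andbT.
    case zx : (z <= x)%O; last by rewrite !andbF.
    by case xz: (x <= z)%O => //=; rewrite (@le_anti _ _ z x) ?zx ?xz // xB.
  move=> y /andP[/andP[xy yB] ny].
  rewrite -mulr_suml (eq_bigl (fun z => (x <= z <= y)%O)).
    by rewrite euler_sum ?mul0r // lt_neqAle eq_sym ny.
  move=> z; case xz: (x <= z)%O => //=; case zy : (z <= y)%O; rewrite ?andbF //= yB andbT.
  by move: zy; rewrite le_eqVlt => /predU1P[->//|/rank_lt]; lia.
have unique x : (rho x <= B)%N -> G x = (-1) ^+ B * F x.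
  have [k] := ubnP (B - rho x); elim: k x => // k IH x Bk xB.
  have [E|ne] := eqVneq (rho x) B; first by rewrite /G /s /e E eqxx mulr1.
  have := zG x xB; rewrite splitx // /e (negPf ne).
  under eq_bigr => z /andP[xz zB].
    rewrite IH //; first over; by move/rank_lt: xz; lia.
  rewrite -mulr_sumr => H.
  have := zF x xB; rewrite splitx // /e (negPf ne) => H'.
  set S := \sum_(_ | _) _ in H H'.
  have -> : F x = - S / 2 by lra.
  have -> : G x = - ((-1) ^+ B * S) / 2 by lra.
  by ring.
(* Here [e x] is -1 and [rho x] has the parity of [B], so the definition of [G] gives the negative
   of the value found in [unique]. *)
move=> x xB par; have := unique x (ltnW xB).
rewrite /G /s /e (ltn_eqF xB) -(signr_odd _ B) -signr_odd.
have -> : odd (rho x) = odd B by move: par; rewrite oddB ?(ltnW xB) //; case: odd; case: odd.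
by case: (odd B); rewrite ?expr1 ?expr0; lra.
Qed.

End RankFunction.

(** * Weighted sums over chains and their relation to flag numbers *)

Lemma sum_subset_cons (I : finType) (V : nmodType) (i : I) (l : seq I) (F : {set I} -> V) :
  i \notin l ->
  \sum_(T : {set I} | T \subset [set j in i :: l]) F T =
  \sum_(T : {set I} | T \subset [set j in l]) (F T + F (i |: T)).
Proof.
move=> il; rewrite big_split /= (bigID (fun T : {set I} => i \in T)) /= addrC; congr (_ + _).
  apply: eq_bigl => T; apply/andP/idP => [[/fintype.subsetP Tl iT]|/fintype.subsetP Tl].
    apply/fintype.subsetP => j jT; have := Tl j jT; rewrite !inE => /predU1P[ji|//].
    by rewrite -ji jT in iT.
  split; last by apply: contra il => /Tl; rewrite inE.
  by apply/fintype.subsetP => j /Tl; rewrite !inE orbC => ->.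
rewrite (reindex_onto (fun T => i |: T) (fun T => T :\ i)) /=; last first.
  by move=> T /andP[_ iT]; rewrite finset.setD1K.
apply: eq_bigl => T; rewrite finset.setU11 andbT; apply/andP/idP.
  move=> [/fintype.subsetP Tl /eqP E]; apply/fintype.subsetP => j jT.
  have iT : i \notin T by rewrite -E !inE eqxx.
  have := Tl j; rewrite !inE jT orbT => /(_ isT) /predU1P[ji|//].
  by rewrite -ji jT in iT.
move=> /fintype.subsetP Tl; have iT : i \notin T.
  by apply: contra il => /Tl; rewrite inE.
split; last by rewrite finset.setU1K.
apply/fintype.subsetP => j; rewrite !inE => /predU1P[->|/Tl]; first by rewrite eqxx.
by rewrite inE orbC => ->.
Qed.

Lemma sorted_enum_succ (n : nat) (S : {set 'I_n}) : sorted ltn [seq i.+1 | i : 'I_n <- enum S].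
Proof.
have tr : transitive (relpre (@nat_of_ord n) ltn) by move=> i j k; exact: ltn_trans.
have : sorted ltn [seq val i | i : 'I_n <- enum 'I_n].
  by rewrite val_enum_ord iota_ltn_sorted.
have -> : enum S = [seq i <- enum 'I_n | i \in S] by rewrite enumT.
by rewrite !sorted_map; rewrite enumT => H; exact: (sorted_filter tr _ H).
Qed.

Section ChainSums.
Context {d : Order.disp_t} {P : finTBPOrderType d}.
Variable rho : P -> nat.

Fixpoint chain_count (s : seq nat) (x : P) : nat :=
  if s is r :: s' then (\sum_(z | (x < z)%O && (rho z == r)) chain_count s' z)%N else 1%N.

(* The chains above x with ranks in s, a chain being weighted by b r for each
   rank r of s that it contains and by a r for each rank r that it avoids. *)
Fixpoint chain_sum (R : comPzRingType) (a b : nat -> R) (s : seq nat) (x : P) : R :=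
  if s is r :: s' then
    a r * chain_sum a b s' x +
    b r * \sum_(z | (x < z)%O && (rho z == r)) chain_sum a b s' z
  else 1.

Lemma card_chains k (s : seq nat) (x : P) : size s = k ->
  #|[pred t : k.-tuple P | path (fun y z : P => (y < z)%O) x t && ([seq rho z | z <- t] == s)]|
  = chain_count s x.
Proof.
elim: k s x => [|k IH] [|r s] x //= => [_|[sk]].
  apply: (@fintype.eq_card1 _ ([tuple] : 0.-tuple P)) => t; rewrite !inE (tuple0 t) /=.
  by rewrite eqxx; apply/esym/eqP/val_inj.
rewrite -sum1_card (reindex (fun p : P * k.-tuple P => [tuple of p.1 :: p.2])) /=; last first.
  exists (fun t : k.+1.-tuple P => (thead t, [tuple of behead t])) => [[z t] _|t _] /=.
    by congr pair; apply: val_inj.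
  by rewrite -tuple_eta.
rewrite (eq_bigl (fun p : P * k.-tuple P => ((x < p.1)%O && (rho p.1 == r)) &&
  (path (fun y z : P => (y < z)%O) p.1 p.2 && ([seq rho z | z <- p.2] == s)))); last first.
  move=> [z t]; rewrite !inE /= eqseq_cons.
  by case: (x < z)%O; case: path; case: (rho z == r).
rewrite -(pair_big_dep (fun z => (x < z)%O && (rho z == r)) (fun z (t : k.-tuple P) =>
  path (fun y z : P => (y < z)%O) z t && ([seq rho z | z <- t] == s)) (fun _ _ => 1%N)) /=.
by apply: eq_bigr => z _; rewrite -IH // sum1_card; apply: eq_card => t; rewrite !inE.
Qed.

(** Unfolding the recursion decides at every rank whether the chain uses it; [T] records these
    choices. *)
Lemma chain_sum_sets (R : comPzRingType) (a b : nat -> R) (n : nat) (l : seq 'I_n) (x : P) :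
  uniq l ->
  chain_sum a b [seq i.+1 | i : 'I_n <- l] x =
  \sum_(T : {set 'I_n} | T \subset [set j in l])
     (\prod_(i <- l) (if i \in T then b i.+1 else a i.+1)) *
     (chain_count [seq i.+1 | i : 'I_n <- l & i \in T] x)%:R.
Proof.
elim: l x => [|i l IH] x /=.
  move=> _; rewrite (big_pred1 finset.set0) ?big_nil ?mul1r // => T /=.
  by rewrite -finset.subset0; congr (_ \subset _); apply/finset.setP => j; rewrite !inE.
move=> /andP[il ul]; rewrite sum_subset_cons // big_split /=.
congr (_ + _).
  rewrite IH // mulr_sumr; apply: eq_bigr => T /fintype.subsetP Tl.
  have iT : i \notin T by apply: contra il => /Tl; rewrite inE.
  by rewrite big_cons (negPf iT) mulrA.
rewrite mulr_sumr; under [LHS]eq_bigr => z _ do rewrite IH // mulr_sumr.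
rewrite exchange_big; apply: eq_bigr => T /fintype.subsetP Tl /=.
have iT : i \notin T by apply: contra il => /Tl; rewrite inE.
rewrite big_cons finset.setU11 /= natr_sum mulr_sumr.
have memT j : j \in l -> (j \in i |: T) = (j \in T).
  by move=> jl; rewrite !inE; case: eqP => // ji; rewrite -ji jl in il.
apply: eq_bigr => z _; rewrite (eq_in_filter memT) -!mulrA; congr (_ * (_ * _)).
by apply: eq_big_seq => j /memT ->.
Qed.

Lemma eq_chain_sum (R : comPzRingType) (a b a' b' : nat -> R) (s : seq nat) (x : P) :
  {in s, a =1 a'} -> {in s, b =1 b'} -> chain_sum a b s x = chain_sum a' b' s x.
Proof.
elim: s x => //= r s IH x ea eb.
have ea' : {in s, a =1 a'} by move=> u us; rewrite ea // inE us orbT.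
have eb' : {in s, b =1 b'} by move=> u us; rewrite eb // inE us orbT.
rewrite ea ?mem_head // eb ?mem_head // IH //; congr (_ + _ * _).
by apply: eq_bigr => z _; rewrite IH.
Qed.

Hypothesis rhoP : rank_function rho.
Variable n : nat.
Hypothesis rho_top : rho \top%O = n.+1.

(** Ranks increase along a chain, so both rank sequences are strictly sorted, and being permutations
    of each other means being equal. *)
Lemma flag_number_chain_count (S : {set 'I_n}) :
  flag_number rho S = chain_count [seq i.+1 | i : 'I_n <- enum S] \bot%O.
Proof.
rewrite -(@card_chains #|S|) ?size_map -?cardE //.
apply: eq_card => t; rewrite !inE.
have sS := sorted_enum_succ S.
case so: (sorted _ t); last first.
  apply/esym/negbTE; rewrite negb_and; apply/orP; left; apply/negP.
  by move=> /path_sorted; rewrite so.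
have st : sorted ltn [seq rho x | x <- t].
  by rewrite sorted_map; apply: sub_sorted so => x y /=; exact: (rank_lt rhoP).
rewrite (_ : perm_eq _ _ = ([seq rho x | x <- t] == [seq i.+1 | i : 'I_n <- enum S])); last first.
  apply/idP/eqP => [pe|->//]; apply: (irr_sorted_eq ltn_trans ltnn) => //.
  exact: perm_mem.
case E : (_ == _); rewrite /= ?andbT ?andbF //; apply/esym.
case: (tval t) so E => [//|y u] /= -> /eqP; rewrite andbT.
case: (enum S) => [|i l] //= [ry _]; rewrite lt_neqAle le0x andbT.
by apply/eqP => y0; move: ry; rewrite -y0 rhoP.1.
Qed.

(** The zero weight at rank [n.+1] forces each contributing chain to end in the top element, whence
    the factor [b n.+1]. This turns any linear form in flag numbers whose coefficients are products
    over ranks into a chain sum. *)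
Lemma sum_flag_number (R : comPzRingType) (a b : nat -> R) : a n.+1 = 0 ->
  chain_sum a b (iota 1 n.+1) \bot%O =
  b n.+1 * \sum_(T : {set 'I_n})
     (\prod_i (if i \in T then b i.+1 else a i.+1)) * (flag_number rho T)%:R.
Proof.
move=> a0; have snoc s x : all (fun r => (r <= n)%N) s -> (rho x <= n)%N ->
    chain_sum a b (s ++ [:: n.+1]) x = b n.+1 * chain_sum a b s x.
  elim: s x => /= [|r s IH] x.
    move=> _ xn; rewrite a0 mul0r add0r (big_pred1 \top%O) // => z /=.
    apply/andP/eqP => [[_ /eqP rz]|->]; first by apply: (rank_eq_top rhoP); rewrite rz rho_top.
    rewrite rho_top eqxx lt_neqAle lex1 andbT; split=> //.
    by apply: contraTneq xn => ->; rewrite rho_top ltnn.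
  move=> /andP[rn sn] xn; rewrite IH // mulrDr; congr (_ + _); first by rewrite mulrCA.
  rewrite mulrCA; congr (_ * _); rewrite mulr_sumr; apply: eq_bigr => z /andP[_ /eqP rz].
  by rewrite IH // rz.
have iotaE : iota 1 n = [seq i.+1 | i : 'I_n <- enum 'I_n].
  by rewrite (iotaDl 1 0) -val_enum_ord -map_comp.
have -> : iota 1 n.+1 = iota 1 n ++ [:: n.+1] by rewrite -(addn1 n) iotaD add1n addn1.
rewrite snoc ?rhoP.1 //; last first.
  by apply/allP => r; rewrite mem_iota; lia.
congr (_ * _); rewrite iotaE chain_sum_sets ?enum_uniq //.
apply: eq_big => T; first by apply/fintype.subsetP => i; rewrite inE mem_enum.
move=> _; rewrite big_enum /= flag_number_chain_count; congr (_ * (chain_count (map _ _) _)%:R).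
by rewrite enumT.
Qed.

Variable R : realFieldType.

Lemma chain_sum_iota (a b : nat -> R) (r : nat) (x : P) : (r <= n)%N ->
  chain_sum a b (iota r.+1 (n.+1 - r)) x =
  a r.+1 * chain_sum a b (iota r.+2 (n.+1 - r.+1)) x +
  b r.+1 * \sum_(z | (x < z)%O && (rho z == r.+1)) chain_sum a b (iota r.+2 (n.+1 - r.+1)) z.
Proof. by move=> rn; rewrite subSn // subSS. Qed.

Hypothesis eulerP : eulerian rho.

(** The chain sums starting at the ranks up to [m], completed by suitable values at rank [m.+1],
    satisfy the recursion of [euler_parity] with bound [m.+1], which kills them at even distance
    from that bound. *)
Lemma chain_sum_even_gap (a b : nat -> R) (m : nat) (x : P) : (m <= n)%N ->
  (forall r, (0 < r <= m)%N -> a r = 1 /\ b r = - (1 / 2)) ->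
  a m.+1 = 0 -> b m.+1 = 1 / 2 -> (rho x <= m)%N -> odd (m - rho x) ->
  chain_sum a b (iota (rho x).+1 (n.+1 - rho x)) x = 0.
Proof.
move=> mn ab am bm xm odd_mx; pose h r := chain_sum a b (iota r.+1 (n.+1 - r)).
(* Chains are sorted by their lowest element [z] with rank above [r] and at most [m]; the term
   [h m y] counts those having none. *)
have hE r y : (r <= m)%N ->
    h r y = h m y - 1 / 2 * \sum_(z | (y < z)%O && (r < rho z <= m)%N) h (rho z) z.
  have [k] := ubnP (m - r); elim: k r => // k IH r rk rm.
  have [->|ne] := eqVneq r m.
    by rewrite big1 ?mulr0 ?subr0 // => z; lia.
  rewrite {1}/h chain_sum_iota; last by lia.
  have [|-> ->] := ab r.+1; first by lia.
  rewrite -/(h _) (IH r.+1); [|lia|lia].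
  rewrite [in RHS](bigID (fun z => rho z == r.+1)) /=.
  rewrite [X in _ = _ - 1 / 2 * (X + _)](eq_big (fun z => (y < z)%O && (rho z == r.+1))
    (fun z => h r.+1 z)); last first.
  - by move=> z /andP[_ /eqP ->].
  - by move=> z; case: (y < z)%O => //=; lia.
  rewrite [X in _ = _ - 1 / 2 * (_ + X)](eq_bigl (fun z => (y < z)%O && (r.+1 < rho z <= m)%N)).
    by set S1 := \sum_(_ | _) _; set S2 := \sum_(_ | _) _; lra.
  by move=> z; case: (y < z)%O => //=; lia.
(* The weights -1/2 up to [m] and 1/2 at [m.+1] differ in sign; the minus sign in the second branch
   makes the recursion uniform. *)
pose F z := if (rho z <= m)%N then h (rho z) z else - h m.+1 z.
have := @euler_parity _ _ _ rhoP eulerP R F m.+1 _ x.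
rewrite /F xm; apply; [|by rewrite ltnS|by rewrite subSn //= negbK].
move=> y; rewrite ltnS => ym; rewrite ym hE // {1}/h chain_sum_iota // am bm -/(h _).
rewrite [X in _ + X](bigID (fun z => (rho z == m.+1))) /=.
rewrite [X in _ + (X + _)](eq_big (fun z => (y < z)%O && (rho z == m.+1))
  (fun z => - h m.+1 z)); last first.
- by move=> z /andP[_ /eqP ->]; rewrite ltnn.
- by move=> z; case: (y < z)%O => //=; lia.
rewrite [X in _ + (_ + X)](eq_big (fun z => (y < z)%O && (rho y < rho z <= m)%N)
  (fun z => h (rho z) z)); last first.
- by move=> z /andP[/andP[_ zm] ne]; rewrite ifT //; lia.
- move=> z; case yz: (y < z)%O => //=; move: (rank_lt rhoP yz); lia.
rewrite sumrN; set S1 := \sum_(_ | _) _; set S2 := \sum_(_ | _) _.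
by lra.
Qed.

(** Every chain of nonzero weight has an element of rank [c], the bottom when [c] is 0, and the sum
    over its continuations vanishes by [chain_sum_even_gap]. *)
Lemma chain_sum_odd_run (a b : nat -> R) (c m : nat) : (c <= m <= n)%N ->
  (c = 0%N \/ a c = 0) -> (forall r, (c < r <= m)%N -> a r = 1 /\ b r = - (1 / 2)) ->
  a m.+1 = 0 -> b m.+1 = 1 / 2 -> odd (m - c) ->
  chain_sum a b (iota 1 n.+1) \bot%O = 0.
Proof.
move=> /andP[cm mn] ac ab am bm odd_mc.
have atc x : rho x = c -> chain_sum a b (iota c.+1 (n.+1 - c)) x = 0.
  (* Only ranks above [c] enter the sum, so the weights at lower ranks may be replaced by those of
     the run. *)
  move=> rx; pose a' r := if (r <= m)%N then 1 else a r.
  pose b' r := if (r <= m)%N then - (1 / 2) else b r.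
  rewrite (@eq_chain_sum _ a b a' b'); first last.
  - by move=> r; rewrite mem_iota /b' => rb; case: ifP => // rm; apply ab; lia.
  - by move=> r; rewrite mem_iota /a' => rb; case: ifP => // rm; apply ab; lia.
  rewrite -rx; apply: (@chain_sum_even_gap a' b' m); rewrite /a' /b' ?rx ?ltnn //.
  by move=> r /andP[_ ->].
case: ac => [c0|ac]; first by have := atc \bot%O; rewrite c0 rhoP.1 subn0; exact.
have below r x : (r < c)%N -> chain_sum a b (iota r.+1 (n.+1 - r)) x = 0.
  have [k] := ubnP (c - r); elim: k r x => // k IH r x rk rc.
  rewrite chain_sum_iota; last by lia.
  have [E|ne] := eqVneq r.+1 c.
    rewrite E ac mul0r add0r big1 ?mulr0 // => z /andP[_ /eqP rz]; exact: atc.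
  rewrite IH ?mulr0 ?add0r; [|lia|lia].
  by rewrite big1 ?mulr0 // => z _; apply: IH; lia.
have [c0|c0] := posnP c; first by have := atc \bot%O; rewrite c0 rhoP.1 subn0; exact.
by have := below 0%N \bot%O c0; rewrite subn0.
Qed.

(* Between consecutive ranks outside V the chain sum is a sum over pairs x < y
   of 1/2, or of (#{z | x < z < y, rho z = t} - 2) / 4 when T meets the gap in t. *)
Lemma chain_sum_nonneg (V T : pred nat) : ~~ V n.+1 -> ~~ V 0%N -> (forall r, T r -> V r) ->
  (forall r t, (r < t)%N -> T r -> T t -> exists2 u, (r < u < t)%N & ~~ V u) ->
  0 <= chain_sum (fun r => if V r then if T r then -1 else 1 else 0)
    (fun r => if V r then if T r then 1 / 2 else 0 else 1 / 2 : R) (iota 1 n.+1) \bot%O.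
Proof.
move=> Vn V0 TV Tsep; set a := fun r => _; set b := fun r => _.
pose h r := chain_sum a b (iota r.+1 (n.+1 - r)).
suff hge0 r x : (r <= n.+1)%N -> ~~ V r -> rho x = r -> 0 <= h r x.
  by have := hge0 0%N \bot%O isT V0 rhoP.1; rewrite /h subn0.
have [k] := ubnP (n.+1 - r); elim: k r x => // k IH r x rk rn Vr rx.
have [->|rn1] := eqVneq r n.+1; first by rewrite /h subnn /= ler01.
(* The least such [e] is the next rank outside [V]. Its weight [a e] is 0, so every contributing
   chain has an element there. *)
have exd : exists e, (r < e)%N && ~~ V e by exists n.+1; rewrite Vn andbT; lia.
case: (ex_minnP exd) => e /andP[re Ve] emin.
have en : (e <= n.+1)%N by apply: emin; rewrite Vn andbT; lia.
have Vin u : (r < u < e)%N -> V u.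
  move=> ru; apply: contraT => Vu; suff: (e <= u)%N by lia.
  by apply: emin; rewrite Vu andbT; lia.
have skip u v y : (r <= u <= v)%N -> (v < e)%N -> (forall w, (u < w <= v)%N -> ~~ T w) ->
    h u y = h v y.
  have [q] := ubnP (v - u); elim: q u => // q IHq u uq ruv ve nT.
  have [->//|uv] := eqVneq u v.
  rewrite {1}/h chain_sum_iota; last by lia.
  have -> : a u.+1 = 1 by rewrite /a Vin ?(negPf (nT u.+1 _)) //; lia.
  have -> : b u.+1 = 0 by rewrite /b Vin ?(negPf (nT u.+1 _)) //; lia.
  rewrite mul1r mul0r addr0 -/(h u.+1).
  by apply: IHq => //; [lia|lia|move=> w ?; apply: nT; lia].
have he y : h e.-1 y = 1 / 2 * \sum_(z | (y < z)%O && (rho z == e)) h e z.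
  rewrite {1}/h chain_sum_iota; last by lia.
  rewrite prednK; last by lia.
  have -> : a e = 0 by rewrite /a (negPf Ve).
  have -> : b e = 1 / 2 by rewrite /b (negPf Ve).
  by rewrite mul0r add0r.
have h_ge0 z : rho z = e -> 0 <= h e z by move=> rz; apply: IH => //; lia.
have [/existsP[t' /andP[rt Tt]]|nT] := boolP [exists t : 'I_e, (r < t)%N && T t]; last first.
  rewrite (skip r e.-1); [|lia|lia|]; last first.
    move=> w rw; apply: contra nT => Tw; apply/existsP.
    have we : (w < e)%N by lia.
    by exists (Ordinal we); rewrite /= Tw andbT; lia.
  rewrite he; apply: mulr_ge0; first by lra.
  by apply: sumr_ge0 => z /andP[_ /eqP]; exact: h_ge0.
move: (nat_of_ord t') (ltn_ord t') rt Tt => t te rt Tt {t'}.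
have noT w : (r < w < e)%N -> w != t -> ~~ T w.
  move=> rw wt; apply/negP => Tw; case: (ltngtP w t) wt => // [wt|tw] _.
    by have [u ru /negP[]] := Tsep _ _ wt Tw Tt; apply: Vin; lia.
  by have [u ru /negP[]] := Tsep _ _ tw Tt Tw; apply: Vin; lia.
rewrite (skip r t.-1); [|lia|lia|by move=> w ?; apply: noT; lia].
rewrite /h chain_sum_iota; last by lia.
rewrite prednK; last by lia.
have -> : a t = -1 by rewrite /a Tt Vin //; lia.
have -> : b t = 1 / 2 by rewrite /b Tt Vin //; lia.
rewrite -/(h t).
have ht y : h t y = 1 / 2 * \sum_(z | (y < z)%O && (rho z == e)) h e z.
  by rewrite (skip t e.-1) ?he //; [lia|lia|by move=> w ?; apply: noT; lia].
under eq_bigr do rewrite ht.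
rewrite ht.
have : \sum_(y | (x < y)%O && (rho y == e)) 2 * h e y <=
    \sum_(i | (x < i)%O && (rho i == t)) \sum_(z | (i < z)%O && (rho z == e)) h e z.
  rewrite [leRHS](exchange_big_dep (fun y => (x < y)%O && (rho y == e))) /=; last first.
    by move=> z y /andP[xz _] /andP[zy ->]; rewrite (lt_trans xz zy).
  apply: ler_sum => y /andP[xy /eqP ry]; rewrite sumr_const -[leRHS]mulr_natl.
  apply: ler_wpM2r; first exact: h_ge0.
  rewrite ler_nat; apply: (leq_trans (two_between rhoP eulerP xy (t := t) _)).
    by rewrite rx ry rt te.
  apply/subset_leq_card/fintype.subsetP => z; rewrite inE => /andP[/andP[xz zy] rz].
  by rewrite unfold_in /= xz rz zy ry eqxx.
rewrite -!mulr_sumr; set S1 := \sum_(_ | _) _; set S2 := \sum_(_ | _) _.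
by lra.
Qed.

End ChainSums.

(** * Alternating sums over sets *)

(** Inserting or removing [k] is a sign-reversing involution. *)
Lemma sum_toggle (K : finType) (V : zmodType) (k : K) (F : {set K} -> V) :
  (forall J : {set K}, k \notin J -> F (k |: J) = - F J) -> \sum_J F J = 0.
Proof.
move=> FE; rewrite (bigID (fun J : {set K} => k \in J)) /=.
rewrite (reindex_onto (fun J => k |: J) (fun J => J :\ k)) /=; last first.
  by move=> J; exact: finset.setD1K.
rewrite (eq_bigl (fun J : {set K} => k \notin J)); last first.
  move=> J; rewrite finset.setU11 /=; apply/eqP/idP => [<-|]; first by rewrite !inE eqxx.
  exact: finset.setU1K.
by rewrite (eq_bigr (fun J => - F J)) // sumrN addNr.
Qed.

Lemma sum_sign_between (K : finType) (R : pzRingType) (A C : {set K}) :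
  \sum_(J : {set K} | (A \subset J) && (J \subset C)) (-1) ^+ #|J| =
  (if A == C then (-1) ^+ #|A| else 0) :> R.
Proof.
case: eqP => [->|/eqP AC].
  by rewrite (big_pred1 C) // => J /=; rewrite finset.eqEsubset andbC.
have [AsC|nAsC] := boolP (A \subset C); last first.
  rewrite big_pred0 // => J; apply: contraNF nAsC => /andP[]; exact: fintype.subset_trans.
have /properP[_ [k kC kA]] : A \proper C by rewrite finset.properEneq AC.
rewrite big_mkcond /=; apply: (sum_toggle (k := k)) => J kJ.
rewrite finset.subUset finset.sub1set kC finset.cardsU1 kJ add1n exprS mulN1r.
have -> : (A \subset k |: J) = (A \subset J).
  apply/idP/idP => /fintype.subsetP AJ; apply/fintype.subsetP => j jA.
    by have := AJ j jA; rewrite !inE => /predU1P[jk|//]; rewrite -jk jA in kA.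
  by rewrite !inE AJ // orbT.
by case: ifP; rewrite ?oppr0.
Qed.

(** * The L-transform and its inverse *)

Section FlagVectors.
Variables (R : realType) (n : nat).
Local Notation vec := 'rV[R]_#|{: {set 'I_n}}|.
Implicit Types (S T Q M V : {set 'I_n}).

Lemma card_compl S : (n - #|S|)%N = #|~: S|.
Proof. by have := finset.cardsC S; rewrite card_ord; lia. Qed.

(** Distributing the global sign over the ranks outside [S] makes each coefficient a product over
    ranks, the shape that [sum_flag_number] produces. *)
Lemma flagL_prod S (v : vec) : flagL S v =
  \sum_(T : {set 'I_n}) (\prod_(i < n) (if i \in T then if i \in S then - (1 / 2) else 1 / 2
                   else if i \in S then 1 else 0)) * coordS v T.
Proof.
rewrite /flagL mulr_sumr big_mkcond; apply: eq_bigr => T _.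
transitivity ((\prod_(i < n) (if i \in ~: S then -1 else 1 : R)) *
  (\prod_(i < n) (if i \in T then - (1 / 2) else if i \in S then 1 else 0)) * coordS v T); last first.
  rewrite -big_split /=; congr (_ * _); apply: eq_bigr => i _.
  by rewrite inE; case: (i \in S); case: (i \in T); rewrite /=; lra.
rewrite -[X in X * _ * _]big_mkcond prodr_const.
rewrite -card_compl.
case: ifPn => [/fintype.subsetP ST|/fintype.subsetPn[i iS iT]]; last first.
  by rewrite [X in _ * X * _](bigD1 i) //= (negPf iT); move: iS;
    rewrite inE => /negPf ->; rewrite mul0r mulr0 mul0r.
rewrite -mulrA; congr (_ * (_ * _)); rewrite -prodr_const big_mkcond /=.
apply: eq_bigr => i _; case: ifPn => // iT; case: ifPn => // iS.
by have := ST i; rewrite inE (negPf iT) iS => /(_ isT).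
Qed.

Lemma coordS_linear T : linear_for *%R (fun v : vec => coordS v T).
Proof. by move=> c u v; rewrite /coordS !mxE. Qed.

Lemma flagL_linear S : linear_for *%R (@flagL R n S).
Proof.
move=> c u v; rewrite !flagL_prod mulr_sumr -big_split; apply: eq_bigr => T _ /=.
by rewrite coordS_linear mulrDr mulrCA.
Qed.

HB.instance Definition _ S :=
  GRing.isLinear.Build R vec R *%R (@flagL R n S) (flagL_linear S).

Lemma facet_form_linear M V : linear_for *%R (@facet_form R n M V).
Proof.
move=> c u v; rewrite /facet_form; under eq_bigr do rewrite linearP.
by rewrite big_split -mulr_sumr mulrDr mulrCA.
Qed.

HB.instance Definition _ M V :=
  GRing.isLinear.Build R vec R *%R (@facet_form R n M V) (facet_form_linear M V).

Definition dual_vec Q : vec :=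
  \row_j (if (enum_val j : {set 'I_n}) \subset ~: Q then 2 ^+ #|(enum_val j : {set 'I_n})| else 0).

Lemma coordS_dual_vec Q T : coordS (dual_vec Q) T = if T \subset ~: Q then 2 ^+ #|T| else 0.
Proof. by rewrite /coordS mxE enum_rankK. Qed.

Lemma coordSP (u v : vec) : (forall T, coordS u T = coordS v T) -> u = v.
Proof. by move=> uv; apply/rowP => j; have := uv (enum_val j); rewrite /coordS enum_valK. Qed.

Lemma flagL_dual_vec S Q : flagL S (dual_vec Q) = (S == Q)%:R.
Proof.
rewrite /flagL; under eq_bigr do rewrite coordS_dual_vec.
rewrite (eq_bigr (fun T => if T \subset ~: Q then (-1) ^+ #|T| else 0)); last first.
  move=> T _; case: ifP => _; last by rewrite mulr0.
  by rewrite -exprMn; congr (_ ^+ _); lra.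
rewrite -big_mkcondr /= sum_sign_between card_compl (inj_eq (can_inj (@finset.setCK _))).
by case: eqP => _; rewrite ?mulr0 // -exprD addnn -signr_odd odd_double expr0.
Qed.

(** After exchanging the sums, the inner alternating sum runs over the sets between [~: T] and
    [~: U] and vanishes unless [T = U]. *)
Lemma vec_expansion (v : vec) : v = \sum_(Q : {set 'I_n}) flagL Q v *: dual_vec Q.
Proof.
apply: coordSP => U.
have -> : coordS (\sum_(Q : {set 'I_n}) flagL Q v *: dual_vec Q) U =
    \sum_(Q : {set 'I_n}) flagL Q v * coordS (dual_vec Q) U.
  by rewrite /coordS summxE; apply: eq_bigr => Q _; rewrite mxE.
rewrite /flagL; under eq_bigr => Q _. rewrite -mulrA mulr_suml mulr_sumr big_mkcond /=; over.
rewrite exchange_big /=.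
rewrite (eq_bigr (fun T => (if T == U then coordS v U else 0))).
  by rewrite -big_mkcond big_pred1_eq.
move=> T _; rewrite (eq_bigr (fun Q =>
  ((- (1 / 2)) ^+ #|T| * coordS v T * 2 ^+ #|U|) *
   (if (~: T \subset Q) && (Q \subset ~: U) then (-1) ^+ #|~: Q| else 0))); last first.
  move=> Q _; rewrite coordS_dual_vec card_compl (finset.subCset T Q) (finset.subsetC Q U).
  by case: (~: Q \subset T); case: (U \subset ~: Q) => /=; rewrite ?mulr0 ?mul0r //; ring.
rewrite -mulr_sumr -big_mkcond (reindex_inj (can_inj (@finset.setCK _))) /=.
rewrite (eq_bigl (fun Q => (U \subset Q) && (Q \subset T))); last first.
  by move=> Q; rewrite !finset.setCS andbC.
under eq_bigr do rewrite finset.setCK.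
rewrite sum_sign_between eq_sym; case: eqP => [->|_]; last by rewrite mulr0.
transitivity ((- (1 / 2) * 2 * -1) ^+ #|U| * coordS v U); first by rewrite !exprMn; ring.
by rewrite [X in X ^+ _](_ : _ = 1) ?expr1n ?mul1r //; lra.
Qed.

End FlagVectors.

(** * Even sets as disjoint unions of pairs *)

(** Membership of the integer [r] itself, undoing the shift of the ordinals. It is defined on all
    natural numbers and false at 0 and beyond [n], so neighbours of a rank can be tested freely. *)
Definition pos (n : nat) (S : {set 'I_n}) (r : nat) : bool :=
  [exists i : 'I_n, (i \in S) && (i.+1 == r)].

Lemma posS (n : nat) (S : {set 'I_n}) (i : 'I_n) : pos S i.+1 = (i \in S).
Proof.
apply/existsP/idP => [[j /andP[jS]]|iS]; last by exists i; rewrite iS eqxx.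
by rewrite eqSS => /eqP/val_inj <-.
Qed.

Lemma pos_bounds (n : nat) (S : {set 'I_n}) (r : nat) : pos S r -> (0 < r <= n)%N.
Proof. by case/existsP => i /andP[_ /eqP <-]; rewrite /= ltn_ord. Qed.

Lemma pos0 (n : nat) (S : {set 'I_n}) : pos S 0 = false.
Proof. by case E: (pos S 0) => //; have := pos_bounds E. Qed.

Lemma pos_max (n : nat) (S : {set 'I_n}) : pos S n.+1 = false.
Proof. by case E: (pos S n.+1) => //; have := pos_bounds E; rewrite ltnn. Qed.

Lemma pos_subset (n : nat) (S T : {set 'I_n}) :
  reflect (forall r, pos S r -> pos T r) (S \subset T).
Proof.
apply: (iffP fintype.subsetP) => ST x; last by rewrite -!posS; exact: ST.
by case/existsP => i /andP[/ST iT /eqP <-]; rewrite posS.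
Qed.

(* q is the disjoint union of the pairs {r, r+1} with s r; at r = 0 the second
   clause reads q 0 = s 0. *)
Definition paired (q s : pred nat) : Prop :=
  (forall r, s r -> ~~ s r.+1) /\ (forall r, q r = s r || s r.-1).

Definition even_pred (q : pred nat) : Prop := exists s : pred nat, paired q s.

(** Pair greedily from the left: [s r] holds when [r] is in [q] and was not already taken by
    [r - 1]. If this is not a pairing, some start [r] has no successor in [q], and it ends a run of
    odd length. *)
Lemma odd_run (q : pred nat) : ~~ q 0%N -> ~ even_pred q ->
  exists c m, [/\ ~~ q c, forall r, (c < r <= m)%N -> q r, ~~ q m.+1 & odd (m - c)].
Proof.
move=> q0 nev; pose fix s r := q r && (if r is r'.+1 then ~~ s r' else true).
have sq r : s r -> q r by case: r => [|r] /andP[].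
have s0 : s 0%N = false by rewrite /= (negPf q0).
have runs r : s r -> exists2 c, ~~ q c & (forall u, (c < u <= r)%N -> q u) /\ odd (r - c).
  have [k] := ubnP r; elim: k r => // k IH [|r] rk; first by rewrite s0.
  move=> sr; have qr1 := sq _ sr; have /andP[_ nsr] := sr.
  have [qr|nqr] := boolP (q r); last first.
    by exists r => //; split=> [u ur|]; [have -> : u = r.+1 by lia|rewrite subSnn].
  case: r rk sr qr1 nsr qr => [|r] rk sr qr1 nsr qr; first by rewrite qr in q0.
  have sr' : s r by move: nsr; rewrite /= -/s in qr *; rewrite qr /= negbK.
  have [c qc [cq odd_c]] := IH r (ltac:(lia)) sr'.
  have cr : (c <= r)%N.
    rewrite leqNgt; apply/negP => rc; move: odd_c;
    by rewrite (eqP (ltnW rc : (_ - _ == 0)%N)).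
  exists c => //; split; last by rewrite !subSn ?(leq_trans cr) //= negbK.
  move=> u cu; have [->//|u1] := eqVneq u r.+2.
  by have [->//|u2] := eqVneq u r.+1; apply: cq; lia.
apply: contrapT => no_run; apply: nev; exists s; split.
  by move=> r sr; rewrite /= sr andbF.
case=> [|r]; first by rewrite s0 (negPf q0).
rewrite [r.+1.-1]/=; have [sr|nsr] := boolP (s r); last by rewrite /= nsr andbT orbF.
rewrite orbT; apply: contraT => nq; have [c qc [cq odd_c]] := runs r sr.
by case: no_run; exists c, r.
Qed.

(** * Relations and inequalities for flag vectors of Eulerian posets *)

Section FlagVectorsOfEulerianPosets.
Variables (R : realType) (n : nat).
Local Notation vec := 'rV[R]_#|{: {set 'I_n}}|.
Implicit Types (S T Q M V : {set 'I_n}).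

(** Summing over [Q] acts rank by rank. At a rank of [V] outside [T] both choices are added, giving
    0 when the rank is in [S] and 1 otherwise; the resulting weights are those of
    [chain_sum_nonneg]. *)
Lemma sum_flagL_between T V (v : vec) : T \subset V ->
  (-1) ^+ #|T| * \sum_(Q : {set 'I_n} | (T \subset Q) && (Q \subset V)) flagL Q v =
  \sum_(S : {set 'I_n}) (\prod_(i < n)
    (if i \in S then if i \in V then if i \in T then 1 / 2 else 0 else 1 / 2
     else if i \in V then if i \in T then -1 else 1 else 0)) * coordS v S.
Proof.
move=> /fintype.subsetP TV; under eq_bigr do rewrite flagL_prod.
rewrite exchange_big mulr_sumr; apply: eq_bigr => S _ /=.
rewrite -mulr_suml mulrA; congr (_ * _).
(* [g] is the factor for [i] in [Q] and [g'] the one for [i] outside [Q]; their zeros enforce that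
   [Q] lies between [T] and [V]. *)
pose g i : R := if i \in V then if i \in S then - (1 / 2) else 1 else 0.
pose g' i : R := if i \in T then 0 else if i \in S then 1 / 2 else 0.
transitivity ((-1) ^+ #|T| * \sum_(Q : {set 'I_n}) \prod_(i < n) (if i \in Q then g i else g' i)).
  congr (_ * _); rewrite big_mkcond; apply: eq_bigr => Q _.
  case: ifPn => [/andP[/fintype.subsetP TQ /fintype.subsetP QV]|].
    apply: eq_bigr => i _; rewrite /g /g'.
    have [iQ|iQ] := boolP (i \in Q); first by rewrite QV.
    by rewrite (negPf (contra (TQ i) iQ)).
  rewrite negb_and => /orP[]/fintype.subsetPn[i i1 i2]; rewrite (bigD1 i) //=.
    by rewrite (negPf i2) /g' i1 mul0r.
  by rewrite i1 /g (negPf i2) mul0r.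
rewrite -bigA_distr -prodr_const [X in X * _]big_mkcond -big_split /=.
apply: eq_bigr => i _; rewrite /g /g'; have := TV i.
by case: (i \in T) => [->//|_]; case: (i \in S); case: (i \in V) => /=; lra.
Qed.

Context {d : Order.disp_t} {P : finTBPOrderType d}.
Variable rho : P -> nat.
Hypotheses (rhoP : rank_function rho) (rho_top : rho \top%O = n.+1) (eulerP : eulerian rho).

Lemma coordS_flag_vector T : coordS (flag_vector R n rho) T = (flag_number rho T)%:R.
Proof. by rewrite /coordS mxE enum_rankK. Qed.

(** Up to the factor 1/2 coming from rank [n.+1], the form is a chain sum whose weights on an odd
    run of [Q] are those of [chain_sum_odd_run]. *)
Lemma flagL_odd Q : ~ even_pred (pos Q) -> flagL Q (flag_vector R n rho) = 0.
Proof.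
move=> /odd_run[|c [m [qc cq qm odd_mc]]]; first by rewrite pos0.
have mn : (m <= n)%N by have /pos_bounds : pos Q m; [apply: cq|]; lia.
pose a r : R := if pos Q r then 1 else 0.
pose b r : R := if pos Q r then - (1 / 2) else 1 / 2.
have a0 : a n.+1 = 0 by rewrite /a pos_max.
have := sum_flag_number rhoP rho_top b a0.
rewrite (@chain_sum_odd_run _ _ _ rhoP n rho_top R eulerP a b c m) //; first last.
- by rewrite /b (negPf qm).
- by rewrite /a (negPf qm).
- by move=> r rb; rewrite /a /b cq.
- by right; rewrite /a (negPf qc).
- by lia.
move=> /esym/eqP; rewrite mulf_eq0 {1}/b pos_max => /orP[/eqP ?|/eqP <-]; first by lra.
rewrite flagL_prod; apply: eq_bigr => T _; rewrite coordS_flag_vector; congr (_ * _).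
by apply: eq_bigr => i _; rewrite /a /b posS.
Qed.

Lemma sum_flagL_nonneg T V : T \subset V ->
  (forall r t, (r < t)%N -> pos T r -> pos T t -> exists2 u, (r < u < t)%N & ~~ pos V u) ->
  0 <= (-1) ^+ #|T| * \sum_(Q : {set 'I_n} | (T \subset Q) && (Q \subset V))
     flagL Q (flag_vector R n rho).
Proof.
move=> TV Tsep; have Vn : ~~ pos V n.+1 by rewrite pos_max.
have V0 : ~~ pos V 0%N by rewrite pos0.
have := @chain_sum_nonneg _ _ _ rhoP n rho_top R eulerP _ _ Vn V0 (elimT (pos_subset _ _) TV) Tsep.
rewrite (sum_flag_number rhoP rho_top) ?pos_max // pmulr_rge0; last by lra.
rewrite sum_flagL_between // => /le_trans; apply; apply: ler_sum => S _.
rewrite coordS_flag_vector le_eqVlt; apply/orP; left; apply/eqP; congr (_ * _).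
by apply: eq_bigr => i _; rewrite !posS.
Qed.

End FlagVectorsOfEulerianPosets.

(** * Limit vectors attached to partitions into blocks *)

Section BlockVectors.
Variables (R : realType) (n : nat) (K : finType) (f : 'I_n -> K) (Q : {set 'I_n}).
Local Notation vec := 'rV[R]_#|{: {set 'I_n}}|.

(** The limit of the flag vectors of block posets, divided by the label count to the power of the
    number of blocks: only sets [T] meeting every block keep a nonzero coordinate. *)
Definition block_vec : vec :=
  \row_j (let T := enum_val j : {set 'I_n} in
    if f @: (T :&: Q) == f @: Q then 2 ^+ #|T| else 0).

Definition union_blocks (J : {set K}) : {set 'I_n} := [set i in Q | f i \in J].

(** Inclusion-exclusion over the set [J] of blocks that [T] is required to avoid. *)
Lemma block_vec_expansion : block_vec =
  \sum_(J : {set K} | J \subset f @: Q) (-1) ^+ #|J| *: dual_vec R (union_blocks J).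
Proof.
apply: coordSP => T; rewrite {1}/coordS mxE enum_rankK /=.
have -> : coordS (\sum_(J : {set K} | J \subset f @: Q) (-1) ^+ #|J| *: dual_vec R (union_blocks J)) T =
    2 ^+ #|T| * \sum_(J : {set K} | (finset.set0 \subset J) &&
      (J \subset f @: Q :\: f @: (T :&: Q))) (-1) ^+ #|J|.
  rewrite /coordS summxE mulr_sumr big_mkcond [RHS]big_mkcond; apply: eq_bigr => J _ /=.
  rewrite finset.sub0set finset.subsetD mxE -/(coordS _ T) coordS_dual_vec.
  case: (J \subset f @: Q) => //=; rewrite mulrC.
  have -> : (T \subset ~: union_blocks J) = [disjoint J & f @: (T :&: Q)].
    rewrite finset.disjoints_subset.
    apply/fintype.subsetP/fintype.subsetP => [TU k kJ|JU i iT]; rewrite !inE.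
      apply/finset.imsetP => -[i]; rewrite inE => /andP[iT iQ] kE.
      by have := TU i iT; rewrite !inE iQ -kE kJ.
    apply/negP => /andP[iQ iJ]; have := JU _ iJ.
    by rewrite inE finset.imset_f // inE iT.
  by case: ifP; rewrite ?mul0r.
rewrite sum_sign_between finset.cards0 expr0 [finset.set0 == _]eq_sym finset.setD_eq0.
have -> : (f @: Q \subset f @: (T :&: Q)) = (f @: (T :&: Q) == f @: Q).
  rewrite finset.eqEsubset; case: (f @: Q \subset _); rewrite ?andbF // andbT.
  by rewrite finset.imsetS // finset.subsetIr.
by case: eqP; rewrite ?mulr1 ?mulr0.
Qed.

End BlockVectors.

(** * Eulerian posets built from block systems *)

Record block_system (n : nat) (K : finType) := BlockSystem {
  support_set : {set 'I_n};
  pair_start : pred nat;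
  block_of : nat -> K;
  support_paired : paired (pos support_set) pair_start;
  block_of_pair : forall r, pair_start r -> block_of r.+1 = block_of r;
  block_convex : forall r s t, (r <= s <= t)%N -> pos support_set r -> pos support_set t ->
    block_of r = block_of t -> pos support_set s /\ block_of s = block_of r
}.

(* Elements are triples (rank, label, copy); the label is free in the ranks of
   the blocks and must agree along a chain within a block. *)
Section BlockPoset.
Variables (n : nat) (K : finType) (B : block_system n K) (N : nat).
Local Notation act := (pos (support_set B)).
Local Notation blk := (block_of B).

(** The label is pinned to 0 off the blocks. The copy bit realizes the horizontal double and is
    pinned at ranks 0 and [n.+1], which leaves one bottom and one top. *)
Definition block_valid (u : 'I_n.+2 * 'I_N.+1 * bool) : bool :=
  (act u.1.1 || (u.1.2 == ord0)) && ((0 < u.1.1 <= n)%N || ~~ u.2).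

Definition block_poset := {u : 'I_n.+2 * 'I_N.+1 * bool | block_valid u}.

Definition same_block (r s : nat) : bool := [&& act r, act s & blk r == blk s].

Definition block_rank (x : block_poset) : nat := (val x).1.1.
Definition block_label (x : block_poset) : 'I_N.+1 := (val x).1.2.

Definition block_lt (x y : block_poset) : bool :=
  (block_rank x < block_rank y)%N &&
  (same_block (block_rank x) (block_rank y) ==> (block_label x == block_label y)).

Lemma block_lt_irr : irreflexive block_lt.
Proof. by move=> x; rewrite /block_lt ltnn. Qed.

(** When the outer ranks share a block, convexity puts the middle rank in it too, so the label is
    passed along. *)
Lemma block_lt_trans : transitive block_lt.
Proof.
move=> y x z /andP[xy lxy] /andP[yz lyz]; apply/andP; split; first exact: ltn_trans xy yz.
apply/implyP => /and3P[ax az /eqP bxz].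
have [|ay bxy] := @block_convex _ _ B _ (block_rank y) _ _ ax az bxz.
  by rewrite (ltnW xy) (ltnW yz).
move: lxy lyz; rewrite /same_block ax ay az bxy -bxz !eqxx /=.
by move=> /eqP -> /eqP ->.
Qed.

HB.instance Definition _ := Finite.on block_poset.
HB.instance Definition _ :=
  @Order.Lt_isPOrder.Build Order.NatOrder.nat_display block_poset block_lt
    block_lt_irr block_lt_trans.

Lemma block_bot_proof : block_valid (ord0, ord0, false).
Proof. by rewrite /block_valid eqxx !orbT. Qed.

Lemma block_top_proof : block_valid (ord_max, ord0, false).
Proof. by rewrite /block_valid eqxx !orbT. Qed.

Definition block_bot : block_poset := Sub _ block_bot_proof.
Definition block_top : block_poset := Sub _ block_top_proof.

Lemma block_ext (x y : block_poset) : block_rank x = block_rank y ->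
  ~~ (0 < block_rank x <= n)%N -> x = y.
Proof.
case: x y => [[[r p] e] vx] [[[s q] f] vy]; rewrite /block_rank /= => /val_inj rs rn.
have an (t : 'I_n.+2) : ~~ (0 < t <= n)%N -> act t = false.
  by move=> tn; apply: contraNF tn => at_; exact: pos_bounds at_.
apply/val_inj => /=; move: vx vy; rewrite /block_valid /= -rs (negPf rn) (an _ rn) /=.
by move=> /andP[/eqP -> /negPf ->] /andP[/eqP -> /negPf ->].
Qed.

Lemma block_le0x (x : block_poset) : (block_bot <= x)%O.
Proof.
rewrite le_eqVlt; have [E|x0] := posnP (block_rank x).
  by rewrite (@block_ext block_bot x) ?eqxx.
by apply/orP; right; apply/andP; split=> //; rewrite /same_block pos0.
Qed.

Lemma block_lex1 (x : block_poset) : (x <= block_top)%O.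
Proof.
rewrite le_eqVlt; have [E|x1] := eqVneq (block_rank x) n.+1.
  by rewrite (@block_ext x block_top) ?eqxx // E ltnn andbF.
apply/orP; right; apply/andP; split; last by rewrite /same_block /= pos_max andbF.
by rewrite ltn_neqAle x1 -ltnS /block_rank ltn_ord.
Qed.

HB.instance Definition _ := Order.hasBottom.Build _ block_poset block_le0x.
HB.instance Definition _ := Order.hasTop.Build _ block_poset block_lex1.

Lemma block_ltE (x y : block_poset) : (x < y)%O = block_lt x y.
Proof. by []. Qed.

Lemma block_rank_lt (x y : block_poset) : (x < y)%O -> (block_rank x < block_rank y)%N.
Proof. by case/andP. Qed.

Lemma card_level (t : nat) (C : pred 'I_N.+1) : (0 < t <= n)%N ->
  #|[pred z : block_poset | (block_rank z == t) && C (block_label z)]| =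
  (2 * #|[pred p | (act t || (p == ord0)) && C p]|)%N.
Proof.
move=> tn; have tn2 : (t < n.+2)%N by lia.
pose U : pred ('I_n.+2 * 'I_N.+1 * bool) :=
  [pred u | (u.1 \in [predX pred1 (Ordinal tn2) & [pred p | (act t || (p == ord0)) && C p]])
            && (u.2 \in predT)].
transitivity #|U|; last by rewrite (cardX _ (mem predT)) cardX card1 mul1n card_bool mulnC.
rewrite -(fintype.card_image val_inj); apply: eq_card => u; rewrite !inE.
apply/fintype.imageP/idP => [[z]|].
  rewrite !inE /block_rank /block_label => /andP[/eqP zt Cz] ->.
  have := valP z; rewrite /block_valid Cz zt !andbT => /andP[-> _]; rewrite andbT.
  by apply/eqP/val_inj.
move=> /andP[/andP[/eqP ut /andP[up uC]] _].
have vu : block_valid u by rewrite /block_valid ut up /= tn.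
by exists (Sub u vu) => //; rewrite !inE /block_rank /block_label /= ut eqxx uC.
Qed.

(** The label at rank [t] is free only if [t] lies in a block containing neither [r] nor [s].
    Otherwise a single value is possible: the inherited label, or [ord0] off the blocks. *)
Lemma card_labels (r s t : nat) (p q : 'I_N.+1) :
  (same_block r t && same_block t s ==> (p == q)) ->
  #|[pred l | (act t || (l == ord0)) &&
      ((same_block r t ==> (p == l)) && (same_block t s ==> (l == q)))]| =
  (1 + N * (act t && ~~ same_block r t && ~~ same_block t s))%N.
Proof.
have sbl r' t' : same_block r' t' -> act r' by case/and3P.
have sbr r' t' : same_block r' t' -> act t' by case/and3P.
case rt: (same_block r t); case ts: (same_block t s) => /=; rewrite ?andbF ?muln0 ?addn0.
- rewrite (sbr _ _ rt) /= => /eqP <-; rewrite -(card1 p); apply: eq_card => l.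
  by rewrite !inE [p == l]eq_sym andbb.
- move=> _; rewrite (sbr _ _ rt) /= -(card1 p); apply: eq_card => l.
  by rewrite !inE eq_sym andbT.
- by move=> _; rewrite (sbl _ _ ts) /= -(card1 q); apply: eq_card => l; rewrite !inE.
- move=> _; case at_ : (act t) => /=; last first.
    rewrite muln0 addn0 -(card1 (ord0 : 'I_N.+1)); apply: eq_card => l.
    by rewrite !inE ?andbT.
  by rewrite muln1 add1n -[in RHS](card_ord N.+1); apply: eq_card => l.
Qed.

Lemma card_above (x : block_poset) (t : nat) : (block_rank x < t <= n)%N ->
  #|[pred z : block_poset | (x < z)%O && (block_rank z == t)]| =
  (2 * (1 + N * (act t && ~~ same_block (block_rank x) t)))%N.
Proof.
(* Rank 0 lies in no block, so taking it as the upper rank in [card_labels] imposes no constraint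
   from above. *)
move=> /andP[xt tn]; have t0 : same_block t 0 = false by rewrite /same_block pos0 andbF.
have := @card_labels (block_rank x) 0 t (block_label x) ord0; rewrite t0 andbF /= andbT.
move=> /(_ isT) <-; rewrite -card_level; last by lia.
apply: eq_card => z; rewrite !inE block_ltE /block_lt andbT.
by case: (eqVneq (block_rank z) t) => [->|_]; rewrite ?andbF //= xt andbT.
Qed.

Lemma card_between (x y : block_poset) (t : nat) : (x < y)%O ->
  (block_rank x < t < block_rank y)%N ->
  #|[pred z : block_poset | (x < z < y)%O && (block_rank z == t)]| =
  (2 * (1 + N * (act t && ~~ same_block (block_rank x) t && ~~ same_block t (block_rank y))))%N.
Proof.
move=> xy /andP[xt ty].
have yn : (block_rank y <= n.+1)%N by rewrite -ltnS /block_rank ltn_ord.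
rewrite -(@card_labels _ _ _ (block_label x) (block_label y)); last first.
  apply/implyP => /andP[/and3P[ax at_ /eqP bxt] /and3P[_ ay /eqP bty]].
  move: xy; rewrite block_ltE => /andP[_ /implyP]; apply.
  by rewrite /same_block ax ay bxt bty /=.
rewrite -card_level; last by lia.
apply: eq_card => z; rewrite !inE !block_ltE /block_lt.
by case: (eqVneq (block_rank z) t) => [->|_]; rewrite ?andbF //= xt ty /= andbT.
Qed.

Lemma block_rank_function : rank_function (block_rank : block_poset -> nat).
Proof.
split=> // x y [xy nz]; have := block_rank_lt xy; rewrite leq_eqVlt => /orP[/eqP <- //|xy2].
have : (0 < #|[pred z : block_poset | (x < z < y)%O && (block_rank z == (block_rank x).+1)]|)%N.
  by rewrite card_between ?muln_gt0 // ltnSn xy2.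
by case/card_gt0P => z; rewrite !inE => /andP[/andP[xz zy] _]; case: (nz z).
Qed.

(** [chi] is a union of pairs, whose two signs cancel; only a pair cut by the bound [m] leaves a
    term. *)
Lemma sum_sign_pairs (q s chi : pred nat) (m : nat) : paired q s ->
  (forall t, chi t -> q t) -> (forall t, s t -> chi t.+1 = chi t) ->
  \sum_(t < m) (-1) ^+ t * (chi t)%:R =
  (if m is m'.+1 then if s m' && chi m' then (-1) ^+ m' else 0 else 0) :> int.
Proof.
move=> [s1 qs] cq cs; elim: m => [|m IH]; first by rewrite big_ord0.
rewrite big_ord_recr /= IH.
case cm: (chi m); last first.
  rewrite mulr0 addr0 andbF; case: m {IH} cm => // m cm.
  by case sm : (s m) => //=; rewrite -(cs _ sm) cm.
rewrite andbT mulr1; have /orP qm : s m || s m.-1 by rewrite -qs cq.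
have [sm|sm] := boolP (s m).
  case: m {IH cm qm} sm => [|m] sm; rewrite ?add0r //.
  by case sm': (s m); rewrite ?add0r //; have := s1 _ sm'; rewrite sm.
have {qm}sm' : s m.-1 by case: qm => // sm'; rewrite sm' in sm.
case: m {IH} sm cm sm' => [|m] sm cm /= sm'; first by rewrite sm' in sm.
by rewrite sm' -(cs _ sm') cm exprS mulN1r subrr.
Qed.

Lemma sum_sign_range (r s : nat) : (r < s)%N ->
  \sum_(t < s | (r < t)%N) (-1) ^+ t * 2 = - ((-1) ^+ r + (-1) ^+ s) :> int.
Proof.
elim: s => // s IH; rewrite ltnS leq_eqVlt => /orP[/eqP ->|rs].
  by rewrite big1 => [|t]; [rewrite exprS; ring|have := ltn_ord t; lia].
by rewrite big_mkcond big_ord_recr -big_mkcond /= rs IH // exprS; ring.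
Qed.

(** A rank [t] strictly inside the interval has 2 elements, plus [2 * N] more if its label is free.
    The ranks with free labels form whole pairs, since the blocks of both ends are removed entirely,
    so this surplus cancels; what remains is the computation with two elements per rank. *)
Lemma block_eulerian : eulerian (block_rank : block_poset -> nat).
Proof.
exists (fun x y => (-1) ^+ (block_rank y - block_rank x)) => //; split.
  by move=> x; rewrite subnn.
move=> x y xy; have rxy := block_rank_lt xy.
have yn : (block_rank y < n.+2)%N by rewrite /block_rank ltn_ord.
rewrite (eq_bigr (fun z => (-1) ^+ block_rank x * (-1) ^+ block_rank z)); last first.
  move=> z /andP[xz _]; rewrite -exprD -signr_odd -[RHS]signr_odd oddD oddB 1?addbC //.
  by move: xz; rewrite le_eqVlt => /predU1P[->//|/block_rank_lt/ltnW].
rewrite -mulr_sumr; apply/eqP; rewrite mulf_eq0 signr_eq0 /=; apply/eqP.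
rewrite (bigD1 x) ?lexx ?ltW //= (bigD1 y) ?lexx ?ltW ?(gt_eqF xy) //=.
rewrite (eq_bigl (fun z => (x < z < y)%O)); last first.
  by move=> z; rewrite !lt_neqAle eq_sym; do 4 case: (_ == _) || case: (_ <= _)%O.
rewrite (partition_big (fun z => (val z).1.1)
  (fun t : 'I_n.+2 => (block_rank x < t < block_rank y)%N)) /=; last first.
  by move=> z /andP[/block_rank_lt xz /block_rank_lt zy]; rewrite xz.
pose chi t := [&& (block_rank x < t < block_rank y)%N, act t,
  ~~ same_block (block_rank x) t & ~~ same_block t (block_rank y)].
rewrite (eq_bigr (fun t : 'I_n.+2 => (-1) ^+ t * 2 + (2 * N)%:R * ((-1) ^+ t * (chi t)%:R))); last first.
  move=> t tb; rewrite (eq_bigr (fun=> (-1) ^+ t)); last by move=> z /andP[_ /eqP <-].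
  rewrite sumr_const -[LHS]mulr_natr.
  have -> : #|[pred z : block_poset | (x < z < y)%O & (val z).1.1 == t]| =
      #|[pred z : block_poset | (x < z < y)%O && (block_rank z == t)]| by [].
  rewrite card_between // /chi tb andTb -andbA natrM natrD !natrM; ring.
rewrite big_split -mulr_sumr /=.
have -> : \sum_(t < n.+2 | (block_rank x < t < block_rank y)%N) (-1) ^+ t * 2 =
    \sum_(t < block_rank y | (block_rank x < t)%N) (-1) ^+ t * 2 :> int.
  by rewrite (big_ord_widen_cond n.+2 (fun t => block_rank x < t)%N (fun t => (-1) ^+ t * 2) (ltnW yn)).
rewrite sum_sign_range // big_mkcond /=.
rewrite (eq_bigr (fun t : 'I_n.+2 => (-1) ^+ t * (chi t)%:R)); last first.
  by move=> t _; case: ifPn => // tb; rewrite /chi (negPf tb) mulr0.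
rewrite (@sum_sign_pairs _ _ chi _ (support_paired B)); first last.
- move=> t st; have := support_paired B => -[_ actE].
  have at1 : act t by rewrite actE st.
  have at2 : act t.+1 by rewrite actE /= st orbT.
  rewrite /chi /same_block at1 at2 (block_of_pair st) /=.
  have [->|tr] := eqVneq (block_rank x) t; first by rewrite at1 eqxx !andbF.
  have [ty|ty] := eqVneq t.+1 (block_rank y).
    by rewrite -ty at2 (block_of_pair st) eqxx !andbF.
  by congr (_ && _); move: tr ty; lia.
- by move=> t /and4P[].
by rewrite /chi pos_max andbF /= andbF mulr0; ring.
Qed.

Definition blocks_met (s : seq nat) : {set K} := [set k | has (fun r => act r && (blk r == k)) s].

(** Each new element has two copies. By convexity the chain elements in one block are consecutive,
    so a label is chosen once per block, except for the block of [x], where it is already fixed. *)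
Lemma block_chain_count (s : seq nat) (x : block_poset) :
  path ltn (block_rank x) s -> all (fun r => (r <= n)%N) s ->
  chain_count (block_rank : block_poset -> nat) s x =
  (2 ^ size s * N.+1 ^ #|blocks_met s :\: blocks_met [:: block_rank x]|)%N.
Proof.
elim: s x => [|r s IH] x /=.
  have -> : blocks_met [::] = finset.set0 by apply/finset.setP => k; rewrite !inE.
  by rewrite finset.set0D finset.cards0.
move=> /andP[xr rs] /andP[rn sn].
rewrite (eq_bigr (fun=> 2 ^ size s * N.+1 ^ #|blocks_met s :\: blocks_met [:: r]|)%N); last first.
  by move=> z /andP[_ /eqP zr]; rewrite IH ?zr.
rewrite -(eq_bigl _ _ (fun z => erefl : z \in [pred z | (x < z)%O && (block_rank z == r)] = _)).
rewrite sum_nat_const card_above ?xr // expnS -!mulnA; congr (_ * _)%N.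
rewrite mulnCA; congr (_ * _)%N.
have in1 t k : (k \in blocks_met [:: t]) = act t && (blk t == k) by rewrite inE /= orbF.
have inr k : (k \in blocks_met (r :: s)) = (act r && (blk r == k)) || (k \in blocks_met s).
  by rewrite !inE.
have between k : act (block_rank x) -> blk (block_rank x) = k -> k \in blocks_met s ->
    act r /\ blk r = k.
  move=> ax <-; rewrite inE => /hasP[t ts /andP[at_ /eqP bt]].
  apply: (@block_convex _ _ B (block_rank x) r t) => //.
  rewrite (ltnW xr) /=; apply: ltnW; move: rs; rewrite path_sortedE; last exact: ltn_trans.
  by case/andP => /allP /(_ t ts).
have [ar|nar] := boolP (act r); last first.
  rewrite andFb muln0 mul1n; congr (_ ^ #|(_ : {set K})|)%N; apply/finset.setP => k.
  rewrite !finset.in_setD !in1 inr (negPf nar) /=; case ks: (k \in _); rewrite ?andbF // andbT.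
  by apply/esym/negP => /andP[ax /eqP bk]; case: (between k ax bk ks) nar => ->.
have [sb|nsb] := boolP (same_block (block_rank x) r).
  rewrite muln0 mul1n; congr (_ ^ #|(_ : {set K})|)%N; apply/finset.setP => k.
  move: sb => /and3P[ax _ /eqP bxr].
  by rewrite !finset.in_setD !in1 inr ar ax bxr /=; case: eqP.
rewrite muln1 add1n -expnS; congr (_ ^ _)%N.
rewrite [RHS](finset.cardsD1 (blk r)) finset.in_setD in1 inr ar eqxx /= andbT.
have -> : act (block_rank x) && (blk (block_rank x) == blk r) = false.
  by apply: contraNF nsb => /andP[ax bx]; rewrite /same_block ax ar bx.
rewrite add1n; congr _.+1; apply: eq_card => k.
rewrite finset.in_setD1 !finset.in_setD !in1 inr ar /= [k == _]eq_sym.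
case: eqP => //= kr; case ks: (k \in _); rewrite ?andbF // andbT.
by apply/esym/negP => /andP[ax /eqP bk]; case: (between k ax bk ks).
Qed.

Lemma block_flag_number (T : {set 'I_n}) :
  flag_number (block_rank : block_poset -> nat) T =
  (2 ^ #|T| * N.+1 ^ #|[set blk (i : 'I_n).+1 | i in T :&: support_set B]|)%N.
Proof.
rewrite (flag_number_chain_count block_rank_function) // block_chain_count; first last.
- by apply/allP => r /mapP[i _ ->].
- rewrite path_min_sorted ?sorted_enum_succ //; apply/allP => r /mapP[i _ ->] //.
rewrite size_map -cardE; congr (_ * _ ^ #|(_ : {set K})|)%N; apply/finset.setP => k.
rewrite !inE /= orbF /block_rank /= pos0.
apply/hasP/finset.imsetP => [[r /mapP[i iT ->] /andP[ai /eqP <-]]|[i]].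
  by exists i => //; rewrite inE -mem_enum iT -posS.
rewrite inE => /andP[iT iB] ->; exists i.+1; last by rewrite posS iB eqxx.
by apply/mapP; exists i => //; rewrite mem_enum.
Qed.

End BlockPoset.

(** * From maximal intervals of integers to runs of natural numbers *)

Definition run (v : pred nat) (a b : nat) : Prop :=
  [/\ (0 < a <= b)%N, forall r, (a <= r <= b)%N -> v r, ~~ v a.-1 & ~~ v b.+1].

Lemma left_end (w : pred nat) (r : nat) : w r ->
  exists a, [/\ (a <= r)%N, forall u, (a <= u <= r)%N -> w u & a = 0%N \/ ~~ w a.-1].
Proof.
elim: r => [|r IH] wr.
  by exists 0%N; split=> //; [move=> u; rewrite leqn0 => /andP[_ /eqP ->]|left].
have [wr'|nwr] := boolP (w r); last first.
  by exists r.+1; split=> //; [move=> u ur; have -> : u = r.+1 by lia|right].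
have [a [ar wa ae]] := IH wr'; exists a; split=> //; first exact: leqW.
by move=> u au; have [->//|ur] := eqVneq u r.+1; apply: wa; lia.
Qed.

Lemma right_end (w : pred nat) (r N : nat) : (r < N)%N -> w r -> ~~ w N ->
  exists b, [/\ (r <= b < N)%N, forall u, (r <= u <= b)%N -> w u & ~~ w b.+1].
Proof.
move=> rN wr wN; have ex : exists b, (r < b)%N && ~~ w b by exists N; rewrite rN.
case: (ex_minnP ex) => b /andP[rb wb] bmin; exists b.-1; split; last by rewrite prednK //; lia.
  by have := bmin N; rewrite rN wN => /(_ isT); lia.
move=> u ub; have [->//|ur] := eqVneq u r; apply: contraT => wu.
have : (b <= u)%N by apply: bmin; rewrite wu andbT; lia.
by lia.
Qed.

Section EltsInt.
Variables (n : nat) (S : {set 'I_n}).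

Lemma eltsP (k : int) : elts S k <-> exists2 r : nat, k = r%:Z & pos S r.
Proof.
split=> [[i /= iS <-]|[r -> /existsP[i /andP[iS /eqP <-]]]]; last by exists i.
by exists i.+1 => //; rewrite posS.
Qed.

Lemma elts_nat (r : nat) : elts S r%:Z <-> pos S r.
Proof.
rewrite eltsP; split=> [[s [->] //]|Sr]; by exists r.
Qed.

Lemma run_max_interval (a b : nat) : run (pos S) a b -> max_interval (elts S) a%:Z b%:Z.
Proof.
move=> [ab Sab Sa Sb]; split; first by lia.
  move=> k; rewrite /zint /= => kab; have [r kr] : exists r : nat, k = r%:Z by exists `|k|%N; lia.
  by rewrite kr; apply/elts_nat/Sab; move: kab; rewrite kr; lia.
move=> c e ce Sce abce.
have [ca be] : c <= a%:Z /\ b%:Z <= e.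
  have := abce a%:Z; have := abce b%:Z; rewrite /zint /=.
  move=> /(_ (ltac:(lia))) H1 /(_ (ltac:(lia))) H2; lia.
have ac : a%:Z <= c.
  rewrite leNgt; apply/negP => ca'; move/negP: Sa; apply; apply/elts_nat/Sce.
  by rewrite /zint /=; lia.
have eb : e <= b%:Z.
  rewrite leNgt; apply/negP => eb'; move/negP: Sb; apply; apply/elts_nat/Sce.
  by rewrite /zint /=; lia.
by congr zint; lia.
Qed.

Lemma run_at (r : nat) : pos S r -> exists a b, run (pos S) a b /\ (a <= r <= b)%N.
Proof.
move=> Sr; have rn := pos_bounds Sr.
have [a [ar Sa ae]] := left_end Sr.
have [|b [rb Sb be]] := @right_end _ r n.+1 _ Sr (negbT (pos_max S)); first by lia.
have a0 : (0 < a)%N.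
  by have /pos_bounds/andP[] : pos S a by apply: Sa; lia.
exists a, b; split; last by lia.
split=> //; first by lia.
  move=> u au; have [ur|ru] := leqP u r; first by apply: Sa; lia.
  by apply: Sb; lia.
by case: ae => // a1; rewrite a1 in a0.
Qed.

(** Four consecutive missing ranks would extend to a maximal interval of the complement with at
    least four elements. *)
Lemma gap_max_interval (r : nat) : (r + 3 <= n.+1)%N ->
  (forall a b : int, max_interval (zint 0 (n.+1%:Z) `\` elts S)%classic a b -> b - a + 1 <= 3) ->
  [|| pos S r, pos S r.+1, pos S r.+2 | pos S r.+3].
Proof.
move=> rn gap; apply: contraT; rewrite !negb_or => /and4P[r0 r1 r2 r3].
(* [pos S] is also false beyond [n.+1], so the complement must be cut off there. *)
pose w u := (u <= n.+1)%N && ~~ pos S u.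
have wr : w r by rewrite /w r0 andbT; lia.
have wr3 : w r.+3 by rewrite /w r3 andbT; lia.
have [a [ar wa ae]] := left_end wr.
have [||b [rb wb be]] := @right_end w r.+3 n.+2 _ wr3; [lia|by rewrite /w ltnn|].
have wab u : (a <= u <= b)%N -> w u.
  move=> uab; have [?|?] := leqP u r; first by apply: wa; lia.
  have [?|?] := leqP r.+3 u; first by apply: wb; lia.
  have /orP[/eqP->|/eqP->] : (u == r.+1) || (u == r.+2) by lia.
    by rewrite /w r1 andbT; lia.
  by rewrite /w r2 andbT; lia.
have wE (u : nat) : (zint 0 (n.+1%:Z) `\` elts S)%classic u%:Z <-> w u.
  rewrite /w /zint /=; split=> [[un /elts_nat/negP ->]|/andP[un /negP Su]].
    by rewrite andbT; lia.
  by split; [lia|move/elts_nat].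
suff : max_interval (zint 0 (n.+1%:Z) `\` elts S)%classic a%:Z b%:Z by move/gap; lia.
split; first by lia.
  move=> k kab; have [u ku] : exists u : nat, k = u%:Z.
    by exists `|k|%N; move: kab; rewrite /zint /=; lia.
  by rewrite ku; apply/wE/wab; move: kab; rewrite ku /zint /=; lia.
move=> c e ce Sce abce.
have [ca eb] : c <= a%:Z /\ b%:Z <= e.
  have := abce a%:Z; have := abce b%:Z; rewrite /zint /=.
  move=> /(_ (ltac:(lia))) H1 /(_ (ltac:(lia))) H2; lia.
have c0 : 0 <= c.
  have := Sce c; rewrite /zint /= => /(_ (ltac:(lia))) [] ; lia.
have ac : a%:Z <= c.
  rewrite leNgt; apply/negP => ca'; have : w a.-1.
    by apply/wE/Sce; rewrite /zint /=; lia.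
  by case: ae => [a0|/negP//]; lia.
have be' : e <= b%:Z.
  rewrite leNgt; apply/negP => eb'; move/negP: be; apply; apply/wE/Sce.
  by rewrite /zint /=; lia.
by congr zint; lia.
Qed.

End EltsInt.

(** Admissibility over natural numbers: [a - 2 = -1] becomes [a = 1] and [b + 2 = n + 2] becomes
    [b = n]. Truncated subtraction is harmless because [m] excludes 0. The bound in the third case
    of [an_pairs] assigns runs of two elements to the second case. *)
Record admissible_nat (n : nat) (m v : pred nat) : Prop := AdmissibleNat {
  an_bounds : forall r, v r -> (0 < r <= n)%N;
  an_sub : forall r, m r -> v r;
  an_run : forall r, v r -> exists a b, run v a b /\ (a <= r <= b)%N;
  an_size : forall a b, run v a b -> (a < b)%N;
  an_pairs : forall a b, run v a b ->
    [\/ forall r, (a <= r <= b)%N -> m r = false,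
        forall r, (a <= r <= b)%N -> m r = (r == a) || (r == a.+1) |
        (a.+1 < b)%N /\ forall r, (a <= r <= b)%N -> m r = (r == b.-1) || (r == b)];
  an_left : forall a b, run v a b -> ~~ m a -> a = 1%N \/ m a.-2;
  an_right : forall a b, run v a b -> ~~ m b -> b = n \/ m b.+2;
  an_gap : forall r, (r + 3 <= n.+1)%N -> [|| v r, v r.+1, v r.+2 | v r.+3]
}.

Lemma admissible_pairP (n : nat) (M V : {set 'I_n}) :
  admissible_pair M V -> admissible_nat n (pos M) (pos V).
Proof.
move=> [[big gap] MV cond].
have ab_lt a b : run (pos V) a b -> (a < b)%N.
  by move=> /run_max_interval /big; lia.
have memE (A : set int) a b r : (elts M `&` zint a%:Z b%:Z)%classic = A ->
    (a <= r <= b)%N -> pos M r <-> A r%:Z.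
  move=> <- rab; rewrite -elts_nat /zint /=; split=> [Mr|[]//]; split=> //; lia.
split.
- by move=> r; exact: pos_bounds.
- exact/pos_subset.
- exact: run_at.
- exact: ab_lt.
- move=> a b ab; have lt := ab_lt _ _ ab.
  have [[c1|c1|c1] _ _] := cond _ _ (run_max_interval ab);
    have E r := memE _ a b r c1.
  + constructor 1 => r rab; case Mr: (pos M r) => //; by have [] := (E _ rab).1 Mr.
  + constructor 2 => r rab; apply/idP/idP => [/(E _ rab).1|ra].
      by rewrite /zint /=; lia.
    by apply/(E _ rab); rewrite /zint /=; lia.
  + have [bE|ab2] := eqVneq b a.+1.
      constructor 2 => r rab; apply/idP/idP => [/(E _ rab).1|ra].
      by rewrite /zint /=; lia.
      by apply/(E _ rab); rewrite /zint /=; lia.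
    constructor 3; split; first by lia.
    move=> r rab; apply/idP/idP => [/(E _ rab).1|ra].
      by rewrite /zint /=; lia.
    by apply/(E _ rab); rewrite /zint /=; lia.
- move=> a b ab nMa; have [_ H _] := cond _ _ (run_max_interval ab).
  have /H[E|/eltsP[r E Mr]] : ~ elts M a%:Z by move/elts_nat; exact/negP.
    by left; move: E => /=; lia.
  by right; have -> : a.-2 = r by lia.
- move=> a b ab nMb; have [_ _ H] := cond _ _ (run_max_interval ab).
  have /H[E|/eltsP[r E Mr]] : ~ elts M b%:Z by move/elts_nat; exact/negP.
    by left; move: E => /=; lia.
  by right; have -> : b.+2 = r by lia.
- by move=> r rn; apply: gap_max_interval.
Qed.

(** * Combinatorics of admissible pairs *)

Section AdmissibleNat.
Variables (n : nat) (m v : pred nat).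
Hypothesis mv : admissible_nat n m v.

(** Condition (i) read from an element of [m]: its run contains just one pair [c], [c.+1] of [m], at
    the left end if [c = a] and at the right end if [c.+1 = b]. *)
Lemma admissible_pair_at (r : nat) : m r -> exists a b c,
  [/\ run v a b, (a <= c < b)%N /\ (c = a \/ (a < c)%N /\ c.+1 = b),
      [/\ m c, m c.+1, ~~ m c.-1 & ~~ m c.+2],
      forall u, (a <= u <= b)%N -> m u = (u == c) || (u == c.+1) &
      r = c \/ r = c.+1].
Proof.
move=> mr; have [a [b [ab rab]]] := an_run mv (an_sub mv mr).
have lt := an_size mv ab; have [a0 vab va vb] := ab.
have ma : m a.-1 = false by apply: contraNF va; exact: (an_sub mv).
have mb : m b.+1 = false by apply: contraNF vb; exact: (an_sub mv).
case: (an_pairs mv ab) => [E|E|[ab2 E]].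
- by rewrite E in mr.
- exists a, b, a; split=> //; last by move: mr; rewrite E //; lia.
  + by split; [lia|left].
  + split; rewrite ?ma //; [by rewrite E; lia|by rewrite E; lia|].
    have [->|ab2] := eqVneq a.+2 b.+1; first by rewrite mb.
    by rewrite E; lia.
- exists a, b, b.-1; have bE : b.-1.+1 = b by lia.
  split=> //; rewrite ?bE //; last by move: mr; rewrite E //; lia.
  + by split; [lia|right; lia].
  + by split; rewrite ?mb // E; lia.
Qed.

Definition pair_left (r : nat) : bool := m r && ~~ m r.-1.

Lemma m0 : m 0 = false.
Proof. by apply/negP => /(an_sub mv)/(an_bounds mv). Qed.

Lemma admissible_paired : paired m pair_left.
Proof.
rewrite /pair_left; split=> [r /andP[mr _]|r]; first by rewrite /= mr andbF.
apply/idP/orP => [mr|[/andP[]//|/andP[mr1 mr2]]].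
  have [a [b [c [_ _ [mc mc1 mc0 _] _ rc]]]] := admissible_pair_at mr.
  by case: rc => ->; [left; rewrite mc|right; rewrite /= mc].
have [a [b [c [_ _ [mc mc1 _ _] _ rc]]]] := admissible_pair_at mr1.
case: r mr1 mr2 rc => [|r] /=; first by rewrite m0.
by move=> _ mr2 [->//|rc]; rewrite rc /= mc in mr2.
Qed.

(* One element of each pair of m, chosen at an end of its run of v. *)
Definition pair_end (r : nat) : bool :=
  (pair_left r && ~~ v r.-1) || (pair_left r.-1 && v r.-2).

Lemma pair_end_sub (r : nat) : pair_end r -> m r.
Proof.
have [_ ->] := admissible_paired.
by case/orP => /andP[-> _]; rewrite ?orbT.
Qed.

Lemma pair_endP (r a b c : nat) : run v a b -> (a <= r <= b)%N -> pair_end r ->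
  (forall u, (a <= u <= b)%N -> m u = (u == c) || (u == c.+1)) -> (a <= c < b)%N ->
  ~~ m c.-1 ->
  (r = c /\ ~~ v c.-1) \/ (r = c.+1 /\ v c.-1).
Proof.
move=> ab rab tr E cab mc0; have mr := pair_end_sub tr.
have mc : m c by rewrite E ?eqxx //; lia.
have : r = c \/ r = c.+1 by move: mr; rewrite E //; lia.
move: tr; rewrite /pair_end /pair_left => tr [rc|rc]; subst r.
  left; split=> //; case/orP: tr => [/andP[] //|/andP[/andP[mc1]]].
  by rewrite (negPf mc0) in mc1.
by right; split=> //; case/orP: tr => [/andP[/andP[_]]|/andP[] //]; rewrite /= mc.
Qed.

(** Without a separating rank, [r] and [t] would lie in one run of [v], which contains one pair of
    [m] and hence one chosen element. This is the separation required by [chain_sum_nonneg]. *)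
Lemma pair_end_sep (r t : nat) : (r < t)%N -> pair_end r -> pair_end t ->
  exists2 u, (r < u < t)%N & ~~ v u.
Proof.
move=> rt er et; apply: contrapT => nsep.
have vrt u : (r < u < t)%N -> v u.
  by move=> ru; apply: contraT => vu; case: nsep; exists u.
have mr := pair_end_sub er; have vt := an_sub mv (pair_end_sub et).
have [a [b [c [ab [cab ce] [mc mc1 mc0 _] E rc]]]] := admissible_pair_at mr.
have rab : (a <= r <= b)%N by lia.
have tb : (t <= b)%N.
  rewrite leqNgt; apply/negP => bt; case: ab => _ _ _ /negP; apply.
  by have [<-//|bt'] := eqVneq t b.+1; apply: vrt; lia.
have tab : (a <= t <= b)%N by lia.
have [[r1 r2]|[r1 r2]] := pair_endP ab rab er E cab mc0;
have [[t1 t2]|[t1 t2]] := pair_endP ab tab et E cab mc0; try lia.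
Qed.

(** The chosen element is at an end of its run, and [q] stays inside [v], so its partner in the
    pairing of [q] can only be the inner neighbour, which is the other element of the pair of
    [m]. *)
Lemma pair_end_cover (q : pred nat) : even_pred q -> (forall r, pair_end r -> q r) ->
  (forall r, q r -> v r) -> forall r, m r -> q r.
Proof.
move=> [s [s1 qs]] tq qv r mr.
have sq u : s u -> q u by rewrite qs => ->.
have sq1 u : s u -> q u.+1 by rewrite qs /= => ->; rewrite orbT.
have [a [b [c [[a0 vab va vb] [cab ce] [mc mc1 mc0 _] E rc]]]] := admissible_pair_at mr.
suff : q c /\ q c.+1 by case=> ? ?; case: rc => ->.
have [vc|vc] := boolP (v c.-1); last first.
  have qc : q c by apply: tq; rewrite /pair_end /pair_left mc mc0 vc.
  split=> //; apply: sq1; move: (qc); rewrite qs => /orP[//|/sq/qv vc'].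
  by rewrite vc' in vc.
have [ca|[ac cb]] := ce; first by rewrite ca (negPf va) in vc.
have qc : q c.+1 by apply: tq; rewrite /pair_end /pair_left /= mc mc0 vc orbT.
split=> //; apply: sq; move: qc; rewrite qs => /orP[/sq1/qv vc'|//].
by rewrite cb (negPf vb) in vc'.
Qed.

(* The third alternative glues a pair of m to an adjacent pair that is not
   contained in v; such a pair is adjacent to m by the conditions on the ends of
   runs and on gaps. *)
Lemma adjacent_pairs (q s : pred nat) : paired q s -> (forall r, q r -> (0 < r <= n)%N) ->
  (forall r, m r -> q r) -> (exists2 r, q r & ~~ m r) ->
  [\/ exists c, s c /\ forall u, (c <= u <= c.+1)%N -> v u /\ ~~ m u,
      exists c, [/\ s c, m c || m c.+1 & ~~ (v c && v c.+1)] |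
      exists c, [/\ s c, s c.+2, [|| m c, m c.+1, m c.+2 | m c.+3] &
                    ~~ [&& v c, v c.+1, v c.+2 & v c.+3]]].
Proof.
move=> [s1 qs] qn mq [p qp mp].
have sq u : s u -> q u by rewrite qs => ->.
have sq1 u : s u -> q u.+1 by rewrite qs /= => ->; rewrite orbT.
have [c [sc pc]] : exists c, s c /\ (p = c \/ p = c.+1).
  move: qp; rewrite qs => /orP[sp|sp]; first by exists p; split; [|left].
  exists p.-1; split=> //; right; suff : (0 < p)%N by lia.
  by have := qn p; rewrite qs sp orbT => /(_ isT); lia.
have [mc|nmc] := boolP (m c || m c.+1).
  constructor 2; have [vc|nvc] := boolP (v c && v c.+1); last by exists c.
  have /orP mc' := mc; have [r [mr rc]] : exists r, m r /\ (r = c \/ r = c.+1).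
    by case: mc' => ?; [exists c; split; [|left]|exists c.+1; split; [|right]].
  have [a [b [e [[a0 vab va vb] [aeb ae] [me me1 me0 me2] E re]]]] := admissible_pair_at mr.
  have pE : p != e /\ p != e.+1 by split; apply: contraNneq mp => ->.
  (* The pair of [m] is misaligned with the pairing [s]: it shares one element with the pair at [c].
     The neighbouring pair of [s] holds its other element and also the rank just outside the run of
     [v]. *)
  have [ce|ce] : c = e.+1 \/ c.+1 = e by clear -pc rc re pE; lia.
    have se : s e.-1.
      have := mq _ me; rewrite qs => /orP[se|//].
      by have := s1 _ se; rewrite -ce sc.
    have e0 : (0 < e)%N by clear -a0 aeb; lia.
    exists e.-1; rewrite prednK // me orbT; split=> //.
    have ea : e = a.
      case: ae => // -[_ eb]; move/andP: vc => [_]; rewrite ce eb => vb'.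
      by rewrite vb' in vb.
    by rewrite ea (negPf va).
  have se : s e.+1.
    have := mq _ me1; rewrite qs /= => /orP[//|se].
    by have := s1 _ sc; rewrite ce se.
  exists e.+1; rewrite me1; split=> //.
  have eb : e.+1 = b.
    case: ae => [ea|[]//]; move/andP: vc => [vc' _].
    by rewrite -ea -ce /= vc' in va.
  by rewrite eb (negPf vb) andbF.
move: nmc; rewrite negb_or => /andP[nmc nmc1].
have c0 : (0 < c)%N by have := qn _ (sq _ sc); lia.
have cn : (c.+1 <= n)%N by have := qn _ (sq1 _ sc); lia.
have [vc|nvc] := boolP (v c && v c.+1).
  constructor 1; exists c; split=> // u cu; move/andP: vc => [vc vc1].
  by have [->|uc] := eqVneq u c; [|have -> : u = c.+1 by lia].
have left_run r : v r -> ~~ v r.-1 -> exists b, run v r b.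
  move=> vr vr1; have [a [b [ab rab]]] := an_run mv vr; exists b.
  suff -> : r = a by [].
  have [//|ra] := eqVneq r a; case: ab => _ vab _ _.
  by rewrite vab in vr1; lia.
have right_run r : v r -> ~~ v r.+1 -> exists a, run v a r.
  move=> vr vr1; have [a [b [ab rab]]] := an_run mv vr; exists a.
  suff -> : r = b by [].
  have [//|rb] := eqVneq r b; case: ab => _ vab _ _.
  by rewrite vab in vr1; lia.
have [mc|mc] : m c.-1 \/ m c.+2.
- have [vc|vc] := boolP (v c).
    have vc1 : ~~ v c.+1 by move: nvc; rewrite vc.
    have [a ac] := right_run _ vc vc1.
    by case: (an_right mv ac nmc) => [cE|]; [lia|right].
  have [vc1|vc1] := boolP (v c.+1).
    have [b cb] := left_run _ vc1 vc.
    by case: (an_left mv cb nmc1) => [cE|]; [lia|left].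
  have [vc2|vc2] := boolP (v c.+2).
    have [b cb] := left_run _ vc2 vc1.
    have [mc2|mc2] := boolP (m c.+2); first by right.
    by case: (an_left mv cb mc2) => [cE|/= mc]; [lia|rewrite mc in nmc].
  have [vc0|vc0] := boolP (v c.-1).
    have cE : c.-1.+1 = c by lia.
    have [|a ac] := right_run _ vc0; first by rewrite cE.
    have [mc2|mc2] := boolP (m c.-1); first by left.
    by case: (an_right mv ac mc2) => [cE'|]; [lia|rewrite cE (negPf nmc1)].
  have := @an_gap _ _ _ mv c.-1; rewrite prednK // (negPf vc0) (negPf vc) (negPf vc1) (negPf vc2).
  by move=> H; suff : false by []; apply: H; lia.
- have qc := mq _ mc; have c1 : (1 < c)%N by have := qn _ qc; lia.
  have sc2 : s c.-2.
    by move: qc; rewrite qs => /orP[sc'|//]; have := s1 _ sc'; rewrite prednK // sc.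
  constructor 3; exists c.-2.
  have -> : c.-2.+1 = c.-1 by lia.
  have -> : c.-1.+1 = c by lia.
  rewrite mc /= orbT; split=> //.
  by apply: contra nvc => /and4P[_ _ -> ->].
- have sc2 : s c.+2.
    have := mq _ mc; rewrite qs /= => /orP[//|sc'].
    by have := s1 _ sc; rewrite sc'.
  constructor 3; exists c; split=> //; first by rewrite mc !orbT.
  by apply: contra nvc => /and4P[-> ->].
Qed.

(** If [i] is not in [m], it has a neighbour in its run also outside [m], and adding both to [m]
    gives [q]. The only obstruction would be a run of three elements containing a pair of [m], which
    the strengthened condition excludes. *)
Lemma even_extension (i : nat) :
  (forall a, run v a a.+2 -> forall r, (a <= r <= a.+2)%N -> m r = false) ->
  v i -> exists q : pred nat, [/\ even_pred q, forall r, m r -> q r, forall r, q r -> v r & q i].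
Proof.
move=> strong vi; have [mi|nmi] := boolP (m i).
  by exists m; split=> //; [exists pair_left; exact: admissible_paired|exact: an_sub mv].
have [a [b [ab iab]]] := an_run mv vi; have lt := an_size mv ab.
have [d [dab nd nd1 id]] : exists d, [/\ (a <= d < b)%N, ~~ m d, ~~ m d.+1 & i = d \/ i = d.+1].
  case: (an_pairs mv ab) => [E|E|[ab2 E]].
  - have [ib|ib] := eqVneq i b; [exists b.-1|exists i];
      by split; rewrite ?E //; lia.
  - have nia : (a.+2 <= i)%N by move: nmi; rewrite E //; lia.
    have b3 : b != a.+2.
      apply/eqP => b2; have := strong a; rewrite -b2 => /(_ ab a).
      by rewrite E ?eqxx ?leqnn ?(ltnW lt) ?orbT // => /(_ isT).
    have [ib|ib] := eqVneq i b; [exists b.-1|exists i];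
      by split; rewrite ?E //; lia.
  - have nib : (i <= b.-2)%N by move: nmi; rewrite E //; lia.
    have b3 : b != a.+2.
      apply/eqP => b2; have := strong a; rewrite -b2 => /(_ ab b).
      by rewrite E ?eqxx ?orbT ?leqnn ?(ltnW lt) ?orbT // => /(_ isT).
    have [ia|ia] := eqVneq i a; [exists a|exists i.-1];
      by split; rewrite ?E //; lia.
have [s1 ms] := admissible_paired; case: (ab) => a0 vab _ _.
exists (fun r => [|| m r, r == d | r == d.+1]); split.
- exists (fun r => pair_left r || (r == d)); split=> [r|r].
    rewrite negb_or => /orP[sr|/eqP ->].
      rewrite s1 //=; apply: contraNneq nd => <-; rewrite ms /= sr orbT //.
    by rewrite /pair_left (negPf nd1) /=; lia.
  rewrite [in LHS]ms; case: (r == d) => /=; rewrite ?orbT //.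
  have -> : (r == d.+1) = (r.-1 == d) by lia.
  by case: pair_left; case: pair_left; case: (r.-1 == d).
- by move=> r ->.
- move=> r /or3P[/(an_sub mv)//|/eqP->|/eqP->]; apply: vab; lia.
- by case: id => ->; rewrite eqxx ?orbT.
Qed.

End AdmissibleNat.

(** * Validity of the inequality *)

Section PairEndSet.
Variables (n : nat) (M V : {set 'I_n}).
Hypothesis mv : admissible_nat n (pos M) (pos V).

Definition pair_end_set : {set 'I_n} := [set i : 'I_n | pair_end (pos M) (pos V) i.+1].

Lemma pos_pair_end_set (r : nat) : pos pair_end_set r = pair_end (pos M) (pos V) r.
Proof.
apply/idP/idP => [/existsP[i /andP[]]|er]; first by rewrite inE => ei /eqP <-.
have /existsP[i /andP[iM /eqP ir]] := pair_end_sub mv er.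
by rewrite -ir posS inE ir.
Qed.

Lemma card_pos (S : {set 'I_n}) : #|S| = (\sum_(r < n.+2) pos S r)%N.
Proof.
rewrite big_ord_recl big_ord_recr /= pos_max pos0 add0n addn0 -sum1_card big_mkcond.
by apply: eq_bigr => i _; rewrite /bump /= add1n posS; case: (i \in S).
Qed.

Lemma sum_pred (F : nat -> bool) : F 0%N = false -> F n.+1 = false ->
  (\sum_(r < n.+2) F r.-1 = \sum_(r < n.+2) F r)%N.
Proof.
by move=> F0 Fn; rewrite big_ord_recl [RHS]big_ord_recr /= F0 Fn add0n addn0.
Qed.

(** This matches the sign of the facet form with the sign in [sum_flagL_nonneg]. Both sides are
    counted by left ends of pairs. *)
Lemma card_pair_end_set : #|M| = #|pair_end_set|.*2.
Proof.
have [s1 ms] := admissible_paired mv.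
have s0 : pair_left (pos M) 0 = false by rewrite /pair_left pos0.
have sn : pair_left (pos M) n.+1 = false by rewrite /pair_left pos_max.
set s := pair_left (pos M) in s1 ms s0 sn.
have sep r : s r && s r.-1 = false.
  case: r => [|r]; rewrite ?s0 //= andbC; case sr: (s r) => //=; exact/negbTE/s1.
transitivity (\sum_(r < n.+2) s r).*2.
  rewrite card_pos -addnn -[in X in (_ + X)%N](@sum_pred s) // -big_split /=.
  by apply: eq_bigr => r _; rewrite ms; have := sep r; do 2 case: (s _).
congr _.*2; rewrite card_pos.
transitivity (\sum_(r < n.+2) ((s r && ~~ pos V r.-1) + (s r && pos V r.-1)))%N.
  by apply: eq_bigr => r _; case: (s r) => //; case: (pos V _).
rewrite big_split /= -(@sum_pred (fun r => s r && pos V r.-1)); first last.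
- by rewrite sn.
- by rewrite s0.
rewrite -big_split /=; apply: eq_bigr => r _.
rewrite pos_pair_end_set /pair_end -/s; have := sep r.
by case: (s r); case: (s r.-1) => //=; case: (pos V _); case: (pos V _).
Qed.

Lemma facet_form_pair_end (R : realType) (d : Order.disp_t) (P : finTBPOrderType d)
    (rho : P -> nat) :
  rank_function rho -> rho \top%O = n.+1 -> eulerian rho ->
  0 <= facet_form M V (flag_vector R n rho).
Proof.
move=> rhoP rho_top eulerP.
have TM : pair_end_set \subset M.
  by apply/pos_subset => r; rewrite pos_pair_end_set; exact: (pair_end_sub mv).
have TV : pair_end_set \subset V.
  by apply: fintype.subset_trans TM _; apply/pos_subset; exact: an_sub mv.
have := @sum_flagL_nonneg R _ _ _ _ rhoP rho_top eulerP _ _ TV.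
rewrite /facet_form card_pair_end_set doubleK => H.
suff -> : \sum_(Q : {set 'I_n} | (M \subset Q) && (Q \subset V)) flagL Q (flag_vector R n rho) =
    \sum_(Q : {set 'I_n} | (pair_end_set \subset Q) && (Q \subset V)) flagL Q (flag_vector R n rho).
  apply: H => r t rt; rewrite !pos_pair_end_set => er et; exact: (pair_end_sep mv rt er et).
rewrite big_mkcond [RHS]big_mkcond; apply: eq_bigr => Q _.
case QV: (Q \subset V); rewrite ?andbF // !andbT.
case: ifPn => MQ; case: ifPn => // TQ.
  by rewrite (fintype.subset_trans TM MQ) in TQ.
(* [Q] contains every chosen element but not all of [M], so it cannot be even. *)
apply/esym/flagL_odd => // ev; move/negP: MQ; apply; apply/pos_subset.
apply: (pair_end_cover mv ev); last exact/pos_subset.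
by move=> r; rewrite -pos_pair_end_set; exact/pos_subset.
Qed.

End PairEndSet.

(** * Block systems supported on a given even set *)

Section BlockSystems.
Variables (n : nat) (Q : {set 'I_n}) (s : pred nat).
Hypothesis Qs : paired (pos Q) s.

(** Blocks are named by numbers [g r] at most [r], so that [inord] is injective on the names
    occurring in [Q]. *)
Lemma block_systemP (g : nat -> nat) :
  (forall r, s r -> g r.+1 = g r) -> (forall r, (g r <= r)%N) ->
  (forall r u t, (r <= u <= t)%N -> pos Q r -> pos Q t -> g r = g t ->
     pos Q u /\ g u = g r) ->
  exists B : block_system n 'I_n.+1, support_set B = Q /\
    forall r t, pos Q r -> pos Q t -> block_of B r = block_of B t <-> g r = g t.
Proof.
move=> gs gr gc.
have inj r t : pos Q r -> pos Q t -> inord (g r) = inord (g t) :> 'I_n.+1 <-> g r = g t.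
  move=> /pos_bounds rn /pos_bounds tn; split=> [|->//].
  have gr1 := gr r; have gt1 := gr t.
  by move=> /(congr1 val); rewrite /= !inordK //; lia.
have bs r : s r -> inord (g r.+1) = inord (g r) :> 'I_n.+1 by move=> /gs ->.
have bc r u t : (r <= u <= t)%N -> pos Q r -> pos Q t ->
    inord (g r) = inord (g t) :> 'I_n.+1 -> pos Q u /\ inord (g u) = inord (g r) :> 'I_n.+1.
  by move=> rut Qr Qt /(inj _ _ Qr Qt) /(gc _ _ _ rut Qr Qt)[-> ->].
by exists (BlockSystem Qs bs bc).
Qed.

Definition pair_of (r : nat) : nat := if s r then r else r.-1.

Lemma pair_of_left (r : nat) : s r -> pair_of r = r.
Proof. by rewrite /pair_of => ->. Qed.

Lemma pair_of_right (r : nat) : s r -> pair_of r.+1 = r.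
Proof. by case: Qs => s1 _ sr; rewrite /pair_of (negPf (s1 _ sr)). Qed.

Lemma pos_left (r : nat) : s r -> pos Q r.
Proof. by case: Qs => _ -> ->. Qed.

Lemma pos_right (r : nat) : s r -> pos Q r.+1.
Proof. by case: Qs => _ -> /= ->; rewrite orbT. Qed.

Lemma pair_ofP (r : nat) : pos Q r ->
  s (pair_of r) /\ (r = pair_of r \/ r = (pair_of r).+1).
Proof.
move=> Qr; have r0 := pos_bounds Qr; move: Qr; case: Qs => _ ->; rewrite /pair_of.
by case sr: (s r) => //= sr'; split=> //; [left|right; lia].
Qed.

Lemma pair_of_convex (r u t : nat) : (r <= u <= t)%N -> pos Q r -> pos Q t ->
  pair_of r = pair_of t -> pos Q u /\ pair_of u = pair_of r.
Proof.
move=> rut Qr Qt E; have [_ r1] := pair_ofP Qr; have [_ t1] := pair_ofP Qt.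
have [->|->] : u = r \/ u = t by lia.
  by [].
by rewrite E.
Qed.

Lemma pair_of_le (r : nat) : (pair_of r <= r)%N.
Proof. by rewrite /pair_of; case: ifP => _ //; exact: leq_pred. Qed.

Lemma pair_blocks : exists B : block_system n 'I_n.+1, support_set B = Q /\
  forall r t, pos Q r -> pos Q t -> block_of B r = block_of B t <-> pair_of r = pair_of t.
Proof.
apply: block_systemP; [|exact: pair_of_le|exact: pair_of_convex].
by move=> r sr; rewrite pair_of_right ?pair_of_left.
Qed.

Definition glue (c r : nat) : nat := if pair_of r == c.+2 then c else pair_of r.

Lemma glued_blocks (c : nat) : s c -> s c.+2 ->
  exists B : block_system n 'I_n.+1, support_set B = Q /\
  forall r t, (c <= r <= c.+3)%N -> (c <= t <= c.+3)%N -> block_of B r = block_of B t.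
Proof.
move=> sc sc2; have glue4 r : (c <= r <= c.+3)%N -> pos Q r /\ glue c r = c.
  move=> rc; have : [\/ r = c, r = c.+1, r = c.+2 | r = c.+3].
    have [?|?] := eqVneq r c; first by constructor 1.
    have [?|?] := eqVneq r c.+1; first by constructor 2.
    have [?|?] := eqVneq r c.+2; first by constructor 3.
    by constructor 4; lia.
  rewrite /glue; case=> ->.
  - by rewrite pair_of_left // pos_left // ifN //; lia.
  - by rewrite pair_of_right // pos_right // ifN //; lia.
  - by rewrite pair_of_left // pos_left // eqxx.
  - by rewrite pair_of_right // pos_right // eqxx.
have glueP r : pos Q r -> glue c r = c -> (c <= r <= c.+3)%N.
  by move=> Qr; have [_ r1] := pair_ofP Qr; rewrite /glue; case: eqP; lia.
have [||| B [BQ BE]] := @block_systemP (glue c).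
- by move=> r sr; rewrite /glue pair_of_right ?pair_of_left.
- move=> r; have := pair_of_le r; rewrite /glue; case: eqP => //; lia.
- move=> r u t rut Qr Qt E; have [rc|rc] := eqVneq (glue c r) c.
    have r4 := glueP _ Qr rc; have t4 := glueP _ Qt (etrans (esym E) rc).
    by rewrite rc; apply: glue4; lia.
  have gE w : glue c w != c -> glue c w = pair_of w by rewrite /glue; case: ifP => //; rewrite eqxx.
  have Ep : pair_of r = pair_of t by rewrite -!gE // -E.
  have [-> Eu] := pair_of_convex rut Qr Qt Ep; split=> //.
  by rewrite /glue Eu.
exists B; split=> // r t /glue4[Qr gr] /glue4[Qt gt].
by apply/BE; rewrite ?gr ?gt.
Qed.

End BlockSystems.

(** The alternatives are the cases in which [facet_form_block_vec_eq0] applies. The blocks are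
    single pairs, except in the last case of [adjacent_pairs], where two pairs are glued. *)
Lemma exists_blocks (n : nat) (M V Q : {set 'I_n}) : admissible_nat n (pos M) (pos V) ->
  even_pred (pos Q) -> Q <> M ->
  exists B : block_system n 'I_n.+1, support_set B = Q /\
    [\/ ~~ (M \subset Q),
        exists2 r, pos Q r & forall u, pos Q u -> block_of B u = block_of B r ->
          pos V u && ~~ pos M u |
        exists r t, [/\ pos M r, ~~ pos V t, pos Q r, pos Q t & block_of B r = block_of B t]].
Proof.
move=> mv [s Qs] QM; have [B [BQ BE]] := pair_blocks Qs.
have [MQ|MQ] := boolP (M \subset Q); last by exists B; split=> //; constructor 1.
have [r Qr nMr] : exists2 r, pos Q r & ~~ pos M r.
  have /fintype.subsetPn[i iQ iM] : ~~ (Q \subset M).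
    by apply/negP => QM'; apply: QM; apply/eqP; rewrite finset.eqEsubset QM' MQ.
  by exists i.+1; rewrite posS.
have [] := adjacent_pairs mv Qs (@pos_bounds _ _) (elimT (pos_subset _ _) MQ).
- by exists r.
- move=> [c [sc cu]]; exists B; split=> //; constructor 2; exists c; first exact: (pos_left Qs sc).
  move=> u Qu /BE; rewrite (pair_of_left sc) => /(_ Qu (pos_left Qs sc)) uc.
  by have [_ u1] := pair_ofP Qs Qu; apply/andP/cu; lia.
- move=> [c [sc mc vc]]; exists B; split=> //; constructor 3.
  have [u [Mu uc]] : exists u, pos M u /\ (u = c \/ u = c.+1).
    by case/orP: mc => ?; [exists c; split; [|left]|exists c.+1; split; [|right]].
  have [t [Vt tc]] : exists t, ~~ pos V t /\ (t = c \/ t = c.+1).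
    by move: vc; rewrite negb_and => /orP[] ?;
      [exists c; split; [|left]|exists c.+1; split; [|right]].
  have atc w : (w = c \/ w = c.+1) -> pos Q w /\ pair_of s w = c.
    case=> ->; first by rewrite (pos_left Qs sc) (pair_of_left sc).
    by rewrite (pos_right Qs sc) (pair_of_right Qs sc).
  have [Qu uE] := atc _ uc; have [Qt tE] := atc _ tc.
  by exists u, t; split=> //; apply/BE; rewrite ?uE ?tE.
- move=> [c [sc sc2 mc vc]]; have [B' [BQ' BE']] := glued_blocks Qs sc sc2.
  exists B'; split=> //; constructor 3.
  have [u Mu uc] : exists2 u, pos M u & (c <= u <= c.+3)%N.
    by case/or4P: mc => ?; [exists c|exists c.+1|exists c.+2|exists c.+3] => //; clear; lia.
  have [t Vt tc] : exists2 t, ~~ pos V t & (c <= t <= c.+3)%N.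
    by move: vc; rewrite !negb_and => /or4P[] ?;
      [exists c|exists c.+1|exists c.+2|exists c.+3] => //; clear; lia.
  have at4 w : (c <= w <= c.+3)%N -> pos Q w.
    move=> wc; have [->|n0] := eqVneq w c; first exact: (pos_left Qs sc).
    have [->|n1] := eqVneq w c.+1; first exact: (pos_right Qs sc).
    have [->|n2] := eqVneq w c.+2; first exact: (pos_left Qs sc2).
    have -> : w = c.+3 by clear -wc n0 n1 n2; lia.
    exact: (pos_right Qs sc2).
  by exists u, t; split=> //; [exact: at4|exact: at4|exact: BE'].
Qed.

(** A subspace of least dimension containing [A] cannot shrink when intersected with another one
    containing [A]. *)
Lemma exists_linear_span (R : realType) (E : vectType R) (A : set E) :
  exists U : {vspace E}, linear_span A U.
Proof.
pose p k := `[< exists U : {vspace E}, (forall x, A x -> x \in U) /\ \dim U = k >].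
have ex : exists k, p k.
  by exists (\dim {:E}); apply/asboolP; exists fullv; split=> // x _; exact: memvf.
case: (ex_minnP ex) => k /asboolP[U [AU dU]] kmin; exists U; split=> // W AW.
have AUW x : A x -> x \in (U :&: W)%VS by move=> Ax; rewrite memv_cap AU ?AW.
have : (\dim U <= \dim (U :&: W))%N by rewrite dU; apply: kmin; apply/asboolP; exists (U :&: W)%VS.
move=> dUW; have /eqP <- : (U :&: W == U)%VS by rewrite eqEdim capvSl.
exact: capvSr.
Qed.

(** * Linear forms and limit points of the closed cone *)

Section Cone.
Variables (R : realType) (n : nat).
Local Notation vec := 'rV[R]_#|{: {set 'I_n}}|.
Local Notation C := (@eulerian_cone R n).

Lemma cone_ge0 (l : {linear vec -> R^o}) :
  (forall v, eulerian_flag_vectors v -> 0 <= l v) -> forall x, C x -> 0 <= l x.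
Proof.
move=> l0 x Cx; rewrite leNgt; apply/negP => lx.
(* [D] exceeds the sum of the absolute values of the coefficients of [l], so a move of size
   [- l x / D] in each coordinate changes [l] by less than [- l x]. *)
pose D := \sum_j `|l (delta_mx 0 j)| + 1.
have D0 : 0 < D by rewrite ltr_wpDl // sumr_ge0.
have e0 : 0 < - l x / D by rewrite divr_gt0 // oppr_gt0.
have [y [[k [c [a [c0 Aa ->]]]] xy]] := Cx _ (nbhsx_ballx x _ e0).
set y' := \sum_(i < k) _ in xy.
have ly : 0 <= l y'.
  rewrite linear_sum; apply: sumr_ge0 => i _; rewrite linearZ.
  by apply: mulr_ge0; [exact: c0|exact/l0/Aa].
have : l y' - l x <= \sum_j (- l x / D) * `|l (delta_mx 0 j)|.
  rewrite -linearB [y' - x]row_sum_delta linear_sum; apply: ler_sum => j _.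
  rewrite linearZ /=; apply: le_trans (ler_norm _) _; rewrite normrM.
  apply: ler_wpM2r => //; have [_ /(_ 0 j)] := xy; rewrite !mxE /ball /= distrC; exact: ltW.
rewrite -mulr_sumr; have -> : \sum_j `|l (delta_mx 0 j)| = D - 1 by rewrite /D addrK.
have -> : - l x / D * (D - 1) = - l x + l x / D by field; rewrite gt_eqF.
have : l x / D < 0 by rewrite pmulr_llt0 // invr_gt0.
lra.
Qed.

Lemma cone_eq0 (l : {linear vec -> R^o}) :
  (forall v, eulerian_flag_vectors v -> l v = 0) -> forall x, C x -> l x = 0.
Proof.
move=> l0 x Cx; apply/eqP; rewrite eq_le; apply/andP; split; last first.
  by apply: cone_ge0 Cx => v /l0 ->.
rewrite -oppr_ge0; pose l' : {linear vec -> R^o} := (-1 : R) \*: l.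
have := @cone_ge0 l'; rewrite /l' /= => H.
by rewrite -mulN1r; apply: (H _ x Cx) => v /l0; rewrite /GRing.scale /= => ->; rewrite mulr0.
Qed.

Lemma flag_vector_block_poset (K : finType) (B : block_system n K) (N : nat) :
  eulerian_flag_vectors (flag_vector R n (@block_rank n K B N)).
Proof.
exists _, (block_poset B N), (@block_rank n K B N); split=> //.
- exact: block_rank_function.
- exact: block_eulerian.
Qed.

Definition block_map (K : finType) (B : block_system n K) (i : 'I_n) : K := block_of B i.+1.

(** After normalization the coordinate at [T] is already exact when [T] meets every block; otherwise
    at least one factor [N.+1] remains in the denominator, and the coordinate is at most
    [2 ^+ n / N.+1%:R]. *)
Lemma cone_block_vec (K : finType) (B : block_system n K) :
  C (block_vec R (block_map B) (support_set B)).
Proof.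
set Q := support_set B; set f := block_map B; set k := #|f @: Q|.
move=> U /nbhs_ballP[e /= e0 eU].
have [N Ne] : exists N : nat, 2 ^+ n / e < N.+1%:R.
  exists (Num.bound (2 ^+ n / e)); apply: lt_trans (archi_boundP _) _.
    by rewrite divr_ge0 ?exprn_ge0 // ltW.
  by rewrite ltr_nat.
have N0 : 0 < N.+1%:R :> R by rewrite ltr0n.
pose y : vec := (N.+1%:R ^- k) *: flag_vector R n (@block_rank n K B N).
exists y; split.
  exists 1%N, (fun=> N.+1%:R ^- k), (fun=> flag_vector R n (@block_rank n K B N)).
  split=> [_|_|]; last by rewrite big_ord1.
    by rewrite invr_ge0 exprn_ge0.
  exact: flag_vector_block_poset.
apply: eU; split=> // i j; rewrite !mxE /ball /= block_flag_number.
set T := enum_val j : {set 'I_n}.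
have -> : [set block_of B (i : 'I_n).+1 | i in T :&: support_set B]%SET = (f @: (T :&: Q))%SET by [].
have sub : f @: (T :&: Q) \subset f @: Q by apply/finset.imsetS/finset.subsetIr.
rewrite natrM !natrX; case: eqP => [->|/eqP ne].
  by rewrite mulrCA mulVf ?mulr1 ?subrr ?normr0 // expf_neq0 // gt_eqF.
have lt : (#|f @: (T :&: Q)| < k)%N by apply: proper_card; rewrite finset.properEneq ne.
rewrite sub0r normrN ger0_norm; last by rewrite mulr_ge0 ?invr_ge0 ?mulr_ge0 ?exprn_ge0.
rewrite mulrCA; apply: le_lt_trans (_ : 2 ^+ n / N.+1%:R < e); last first.
  by rewrite ltr_pdivrMr // mulrC -ltr_pdivrMr.
apply: ler_pM; rewrite ?exprn_ge0 ?mulr_ge0 ?invr_ge0 ?exprn_ge0 //.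
  by rewrite ler_weXn2l ?ler1n // -[leqRHS](card_ord n) max_card.
rewrite mulrC ler_pdivrMr ?exprn_gt0 // mulrC ler_pdivlMr // -exprSr.
by rewrite ler_weXn2l // ler1n.
Qed.

End Cone.

(** * The face spanned by block vectors *)

Section FacetForm.
Variables (R : realType) (n : nat).
Local Notation vec := 'rV[R]_#|{: {set 'I_n}}|.
Implicit Types (M V Q : {set 'I_n}).

Lemma facet_form_dual_vec M V Q : facet_form M V (dual_vec R Q) =
  (-1) ^+ (#|M|./2) * ((M \subset Q) && (Q \subset V))%:R.
Proof.
rewrite /facet_form; congr (_ * _); under eq_bigr do rewrite flagL_dual_vec.
rewrite big_mkcond (bigD1 Q) //= eqxx big1 ?addr0; last first.
  by move=> S /negPf ->; case: ifP.
by case: (_ && _).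
Qed.

Lemma facet_form_block_vec M V (K : finType) (f : 'I_n -> K) Q :
  facet_form M V (block_vec R f Q) = (-1) ^+ (#|M|./2) *
  \sum_(J : {set K} | (J \subset f @: Q) &&
     ((M \subset union_blocks f Q J) && (union_blocks f Q J \subset V))) (-1) ^+ #|J|.
Proof.
rewrite block_vec_expansion linear_sum big_mkcondr mulr_sumr /=; apply: eq_bigr => J _.
rewrite linearZ /= facet_form_dual_vec mulrCA; congr (_ * _).
by case: ifP; rewrite ?mulr1 ?mulr0.
Qed.

(** In the first and third cases no union of blocks lies between [M] and [V]: in the third, the
    block of [r] would be both required by [M] and forbidden by [V]. In the second, toggling the
    block of [r] respects both inclusions and flips the sign. *)
Lemma facet_form_block_vec_eq0 M V (B : block_system n 'I_n.+1) :
  [\/ ~~ (M \subset support_set B),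
      exists2 r, pos (support_set B) r & forall u, pos (support_set B) u ->
        block_of B u = block_of B r -> pos V u && ~~ pos M u |
      exists r t, [/\ pos M r, ~~ pos V t, pos (support_set B) r, pos (support_set B) t &
        block_of B r = block_of B t]] ->
  facet_form M V (block_vec R (block_map B) (support_set B)) = 0.
Proof.
set Q := support_set B; set f := block_map B => H.
rewrite facet_form_block_vec; apply/eqP; rewrite mulf_eq0 signr_eq0 /=; apply/eqP.
have UQ J : union_blocks f Q J \subset Q by apply/fintype.subsetP => i; rewrite inE => /andP[].
case: H => [MQ|[r Qr Hr]|[r [t [Mr Vt Qr Qt rt]]]].
- by rewrite big_pred0 // => J; apply/negP => /and3P[_ MU _];
    rewrite (fintype.subset_trans MU (UQ J)) in MQ.
- have [i iQ ir] : exists2 i : 'I_n, i \in Q & i.+1 = r.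
    by case/existsP: Qr => i /andP[iQ /eqP ir]; exists i.
  rewrite big_mkcond; apply: (@sum_toggle _ _ (f i)) => J iJ.
  have memU j : (j \in union_blocks f Q (f i |: J)) =
      (j \in union_blocks f Q J) || ((j \in Q) && (f j == f i)).
    by rewrite !inE; case: (j \in Q) => //=; rewrite orbC.
  have blockV j : j \in Q -> f j == f i -> (j \in V) && (j \notin M).
    by move=> jQ /eqP fj; rewrite -!posS; apply: Hr; rewrite ?posS // -ir.
  have -> : (f i |: J \subset f @: Q) = (J \subset f @: Q).
    by rewrite finset.subUset finset.sub1set finset.imset_f.
  have -> : (M \subset union_blocks f Q (f i |: J)) = (M \subset union_blocks f Q J).
    apply/fintype.subsetP/fintype.subsetP => MU j jM; have := MU j jM.
      by rewrite memU => /orP[//|/andP[jQ fj]]; have := blockV j jQ fj; rewrite jM andbF.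
    by rewrite memU => ->.
  have -> : (union_blocks f Q (f i |: J) \subset V) = (union_blocks f Q J \subset V).
    apply/fintype.subsetP/fintype.subsetP => UV j.
      by move=> jU; apply: UV; rewrite memU jU.
    by rewrite memU => /orP[/UV//|/andP[jQ fj]]; have /andP[] := blockV j jQ fj.
  rewrite finset.cardsU1 iJ add1n exprS mulN1r.
  by case: ifP; rewrite ?oppr0.
- rewrite big_pred0 // => J; apply/negP => /and3P[_ /fintype.subsetP MU /fintype.subsetP UV].
  case/existsP: Mr => i /andP[iM /eqP ir]; case/existsP: Qt => j /andP[jQ /eqP jt].
  have := MU i iM; rewrite inE => /andP[_ fiJ].
  move/negP: Vt; apply; rewrite -jt posS; apply: UV; rewrite inE jQ.
  by rewrite /f /block_map jt -rt -ir.
Qed.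

(** Only the union of all blocks contains [M], so a single term survives. *)
Lemma facet_form_block_vec_neq0 M V (B : block_system n 'I_n.+1) :
  M \subset V -> support_set B = M ->
  facet_form M V (block_vec R (block_map B) (support_set B)) != 0.
Proof.
move=> MV BM; rewrite facet_form_block_vec BM; set f := block_map B.
rewrite (big_pred1 (f @: M)%SET); first by rewrite mulf_neq0 // signr_eq0.
move=> J /=; apply/and3P/eqP => [[JM /fintype.subsetP MU _]|->].
  apply/eqP; rewrite finset.eqEsubset JM; apply/fintype.subsetP => k /finset.imsetP[i iM ->].
  by have := MU i iM; rewrite inE => /andP[].
split=> //; apply/fintype.subsetP => i; rewrite !inE; last by case/andP => /(fintype.subsetP MV).
by move=> iM; rewrite iM finset.imset_f.
Qed.

Lemma even_union_blocks (B : block_system n 'I_n.+1) (J : {set 'I_n.+1}) :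
  even_pred (pos (union_blocks (block_map B) (support_set B) J)).
Proof.
have [s1 Qs] := support_paired B.
exists (fun r => pair_start B r && (block_of B r \in J)); split=> [r /andP[/s1/negPf -> _] //|r].
have -> : pos (union_blocks (block_map B) (support_set B) J) r =
    pos (support_set B) r && (block_of B r \in J).
  apply/existsP/andP => [[i /andP[]]|[/existsP[i /andP[iQ /eqP ir]] rJ]].
    by rewrite inE => /andP[iQ iJ] /eqP <-; rewrite posS.
  by exists i; rewrite inE iQ /block_map ir rJ eqxx.
rewrite Qs; case: r => [|r] /=; first by rewrite !orbb.
case sr: (pair_start B r); last by rewrite !orbF.
by rewrite (block_of_pair sr) (negPf (s1 _ sr)).
Qed.

(** The expansion of a block vector is triangular: besides the leading [dual_vec R Q] it involves
    only smaller even sets, which are handled by induction on cardinality. *)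
Lemma dual_vec_mem (W : {vspace vec}) :
  (forall Q, even_pred (pos Q) -> exists2 B : block_system n 'I_n.+1, support_set B = Q &
     block_vec R (block_map B) (support_set B) \in W) ->
  forall Q, even_pred (pos Q) -> dual_vec R Q \in W.
Proof.
move=> HW Q; have [k] := ubnP #|Q|; elim: k Q => // k IH Q Qk ev.
have [B BQ] := HW Q ev; rewrite block_vec_expansion BQ; set f := block_map B.
rewrite (bigD1 (f @: Q)%SET) //=.
have -> : union_blocks f Q (f @: Q)%SET = Q.
  by apply/finset.setP => i; rewrite inE; case iQ: (i \in Q) => //=; rewrite finset.imset_f.
set rest := \sum_(J | _) _ => Wsum.
have Wrest : rest \in W.
  apply: memv_suml => J /andP[JQ nJ]; apply/memvZ/IH; last first.
    by rewrite /f -BQ; exact: even_union_blocks.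
  apply: (@leq_trans #|Q|); last by rewrite -ltnS.
  apply: proper_card; apply/properP; split.
    by apply/fintype.subsetP => i; rewrite inE => /andP[].
  have /fintype.subsetPn[k' /finset.imsetP[i iQ ->] iJ] : ~~ (f @: Q \subset J).
    by apply: contra nJ => QJ; rewrite finset.eqEsubset JQ.
  by exists i; rewrite ?inE ?iQ.
have : (-1) ^+ #|f @: Q| *: dual_vec R Q \in W by rewrite -(addrK rest (_ *: _)) memvB.
by move=> /(memvZ ((-1) ^+ #|f @: Q|)); rewrite scalerA -expr2 sqrr_sign scale1r.
Qed.

Lemma cone_sub_span (W : {vspace vec}) :
  (forall Q, even_pred (pos Q) -> dual_vec R Q \in W) ->
  forall x, @eulerian_cone R n x -> x \in W.
Proof.
move=> HW x Cx; rewrite (vec_expansion x); apply: memv_suml => Q _.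
have [ev|nev] := pselect (even_pred (pos Q)); first exact/memvZ/HW.
suff -> : flagL Q x = 0 by rewrite scale0r mem0v.
pose l : {linear vec -> R^o} := @flagL R n Q.
apply: (@cone_eq0 R n l) Cx => v [d [P [rho [rhoP rho_top eulerP ->]]]].
exact: flagL_odd.
Qed.

Section AdmissiblePair.
Variables (M V : {set 'I_n}).
Hypothesis MV : admissible_pair M V.

Lemma cone_facet_form_ge0 x : @eulerian_cone R n x -> 0 <= facet_form M V x.
Proof.
pose l : {linear vec -> R^o} := @facet_form R n M V.
apply: (@cone_ge0 R n l) => v [d [P [rho [rhoP rho_top eulerP ->]]]].
exact: (facet_form_pair_end (admissible_pairP MV)).
Qed.

Lemma facet_block_vec Q : even_pred (pos Q) -> Q <> M ->
  exists2 B : block_system n 'I_n.+1, support_set B = Q &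
    equality_face (@eulerian_cone R n) (@facet_form R n M V)
      (block_vec R (block_map B) (support_set B)).
Proof.
move=> ev QM; have [B [BQ H]] := exists_blocks (admissible_pairP MV) ev QM.
exists B => //; split; first exact: cone_block_vec.
by apply: facet_form_block_vec_eq0; rewrite BQ.
Qed.

Lemma nonfacet_block_vec : exists2 B : block_system n 'I_n.+1, support_set B = M &
  facet_form M V (block_vec R (block_map B) (support_set B)) != 0.
Proof.
have [B [BM _]] := pair_blocks (admissible_paired (admissible_pairP MV)).
by exists B => //; apply: facet_form_block_vec_neq0 => //; case: MV.
Qed.

Lemma facet_form_facet : determines_facet (@eulerian_cone R n) (@facet_form R n M V).
Proof.
split; first exact: cone_facet_form_ge0.
set l := @facet_form R n M V; pose C := @eulerian_cone R n.
have [U [CU Umin]] := exists_linear_span C.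
have [W [FW Wmin]] := exists_linear_span (equality_face C l).
exists U, W; split=> //.
have [B BM lB] := nonfacet_block_vec; set v := block_vec _ _ _ in lB.
have Cv : C v by exact: cone_block_vec.
have WU : (W <= U)%VS by apply: Wmin => x [Cx _]; exact: CU.
(* Suitable block vectors of all even sets other than [M] lie on the face, and [v] supplies the one
   for [M]; together they generate the span of the cone. *)
have UE : U = (W + <[v]>)%VS.
  apply: subv_anti; rewrite subv_add WU -memvE CU // !andbT; apply: Umin.
  apply: cone_sub_span; apply: dual_vec_mem => Q ev.
  have [->|/eqP QM] := eqVneq Q M.
    by exists B => //; apply: (subvP (addvSr _ _)); exact: memv_line.
  have [B' BQ' face] := facet_block_vec ev QM.
  by exists B' => //; apply: (subvP (addvSl _ _)); exact: FW.
pose lf : 'Hom(vec, R^o) := linfun (l : {linear vec -> R^o}).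
(* The form vanishes on the span of its face but not at [v]. *)
have vW : v \notin W.
  apply: contra lB => vW; have : v \in lker lf.
    by apply: (subvP (Wmin _ _)) vW => x [_ lx]; rewrite memv_ker lfunE; exact/eqP.
  by rewrite memv_ker lfunE.
have v0 : v != 0 by apply: contraNneq vW => ->; exact: mem0v.
rewrite UE dimv_disjoint_sum ?dim_vline ?v0 ?addn1 //.
apply/eqP; rewrite -subv0; apply/subvP => x /memv_capP[xW /vlineP[c xE]].
rewrite memv0; have [c0|c0] := eqVneq c 0; first by rewrite xE c0 scale0r.
by move: vW; rewrite -(scalerK c0 v) -xE memvZ.
Qed.

End AdmissiblePair.

(** * Distinctness of the facets *)

Lemma strong_run M V a : strongly_admissible_pair M V -> run (pos V) a a.+2 ->
  forall r, (a <= r <= a.+2)%N -> pos M r = false.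
Proof.
move=> [_ strong] /run_max_interval ra r ra2; case Mr: (pos M r) => //.
have aE : a.+2%:Z = a%:Z + 2 by lia.
have := strong a%:Z; rewrite -aE => /(_ ra) E.
have : (elts M `&` zint a%:Z a.+2%:Z)%classic r%:Z.
  by split; [exact/elts_nat|rewrite /zint /=; lia].
by rewrite E.
Qed.

(** By [even_extension], [V] is the union of the even sets between [M] and [V]. *)
Lemma support_le M V V' :
  strongly_admissible_pair M V ->
  (forall Q, even_pred (pos Q) -> M \subset Q -> Q \subset V -> Q \subset V') ->
  V \subset V'.
Proof.
move=> sMV H; have mv := admissible_pairP sMV.1; apply/fintype.subsetP => i iV.
have [|q [ev mq qv qi]] := even_extension mv (i := i.+1) (fun a => strong_run sMV (a := a)).
  by rewrite posS.
pose Q := [set j : 'I_n | q j.+1].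
have QE r : pos Q r = q r.
  apply/existsP/idP => [[j /andP[]]|qr]; first by rewrite inE => qj /eqP <-.
  have /existsP[j /andP[_ /eqP jr]] := qv _ qr.
  by exists j; rewrite inE jr qr eqxx.
have evQ : even_pred (pos Q) by case: ev => s [s1 qs]; exists s; split=> // r; rewrite QE.
have QV' : Q \subset V'.
  apply: H => //; apply/pos_subset => r; rewrite QE; [exact: mq|exact: qv].
by apply: (fintype.subsetP QV'); rewrite inE.
Qed.

End FacetForm.

Theorem theorem4p6 (R : realType) (n : nat) :
  (forall M V : {set 'I_n}, admissible_pair M V ->
     determines_facet (@eulerian_cone R n) (@facet_form R n M V)) /\
  (forall M V M' V' : {set 'I_n},
     strongly_admissible_pair M V -> strongly_admissible_pair M' V' ->
     (M, V) <> (M', V') ->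
     equality_face (@eulerian_cone R n) (@facet_form R n M V) <>
     equality_face (@eulerian_cone R n) (@facet_form R n M' V')).
Proof.
split=> [M V|M V M' V' sMV sMV' ne faceE]; first exact: facet_form_facet.
have ev_of (N U : {set 'I_n}) : strongly_admissible_pair N U -> even_pred (pos N).
  by move=> sNU; exists (pair_left (pos N)); exact: (admissible_paired (admissible_pairP sNU.1)).
have sub_of (N U : {set 'I_n}) : strongly_admissible_pair N U -> N \subset U by case=> -[].
have [B BM lB] := nonfacet_block_vec R sMV.1; set v := block_vec _ _ _ in lB.
set l := @facet_form R n M V in lB faceE; set l' := @facet_form R n M' V' in faceE.
(* With this ratio [phi] vanishes at [v], and it vanishes on the common face; these block vectors
   generate the dual vectors of all even sets, so the two forms are proportional there. *)
pose c := l' v / l v.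
pose phi : {linear 'rV[R]_#|{: {set 'I_n}}| -> R^o} :=
  (l' : {linear 'rV[R]_#|{: {set 'I_n}}| -> R^o}) \- (c : R) \*: (l : {linear _ -> R^o}).
have prop Q : even_pred (pos Q) -> l' (dual_vec R Q) = c * l (dual_vec R Q).
  move=> ev; suff : dual_vec R Q \in lker (linfun phi).
    by rewrite memv_ker lfunE /= subr_eq0 => /eqP.
  apply: dual_vec_mem Q ev => Q ev; have [->|/eqP QM] := eqVneq Q M.
    exists B => //; rewrite memv_ker lfunE /= subr_eq0; apply/eqP.
    by rewrite /c -/v /GRing.scale /= divfK.
  have [B' BQ' face] := facet_block_vec R sMV.1 ev QM; exists B' => //.
  have l0 : l (block_vec R (block_map B') (support_set B')) = 0 by case: face.
  have l0' : l' (block_vec R (block_map B') (support_set B')) = 0.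
    by rewrite -/l faceE in face; case: face.
  by rewrite memv_ker lfunE; apply/eqP; rewrite /= -/l -/l' l0 l0' scaler0 subr0.
have dualE (N U Q : {set 'I_n}) : (facet_form N U (dual_vec R Q) != 0) = (N \subset Q) && (Q \subset U).
  by rewrite facet_form_dual_vec mulf_eq0 signr_eq0 /= pnatr_eq0 eqb0 negbK.
(* The even set [M'] is a witness, since the second form is nonzero on its dual vector. *)
have c0 : c != 0.
  have : l' (dual_vec R M') != 0 by rewrite dualE fintype.subxx (sub_of _ _ sMV').
  by rewrite prop ?mulf_eq0 ?negb_or => [/andP[]|]; last exact: (ev_of _ _ sMV').
have same Q : even_pred (pos Q) ->
    (M \subset Q) && (Q \subset V) = (M' \subset Q) && (Q \subset V').
  move=> ev; rewrite -!dualE; change ((l (dual_vec R Q) != 0) = (l' (dual_vec R Q) != 0)).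
  by rewrite prop // [c * _ == 0]mulf_eq0 (negPf c0).
(* [M] and [M'] are themselves even, so testing [same] on each gives both inclusions. *)
have MM' : M = M'.
  apply/eqP; rewrite finset.eqEsubset.
  have := same M' (ev_of _ _ sMV'); rewrite fintype.subxx (sub_of _ _ sMV') => /andP[-> _].
  have := same M (ev_of _ _ sMV); rewrite fintype.subxx (sub_of _ _ sMV) => /esym/andP[-> _].
  by [].
apply: ne; subst M'; congr pair; apply/eqP; rewrite finset.eqEsubset.
apply/andP; split.
  by apply: (support_le sMV) => Q ev MQ QV; have := same Q ev; rewrite MQ QV => /esym/andP[].
by apply: (support_le sMV') => Q ev MQ QV; have := same Q ev; rewrite MQ QV => /andP[].
Qed.
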